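(* Let $\varphi^*$ be the unitary totient function, and let $F_{\varphi^*}(X)$ denote the number of $\varphi^*$-practical positive integers $n\le X$. There exist positive constants $l$ and $u$ such that $$ l\,\frac{X}{\log X}\le F_{\varphi^*}(X)\le u\,\frac{X}{\log X}$$ for all real $X\ge 2$.
   Context: The unitary totient function $\varphi^*$ is the multiplicative function with $\varphi^*(1)=1$ and $\varphi^*(p^k)=p^k-1$ for every prime $p$ and integer $k\ge1$. For a multiplicative $f$ put $S_f(n)=\sum_{d\mid n}f(d)$. A positive integer $n$ is $f$-practical if every positive integer $m\le S_f(n)$ can be written as $\sum_{d\in\mathcal{D}} f(d)$ for some set $\mathcal{D}$ of distinct positive divisors of $n$. *)

(* Defs.v *)
From mathcomp Require Import all_boot.
Set Implicit Arguments. Unset Strict Implicit. Unset Printing Implicit Defensive.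

(* Unitary totient: multiplicative, phi*(1) = 1, phi*(p^k) = p^k - 1.
   Written via the prime factorization n = prod_p p^(logn p n). *)
Definition ustar (n : nat) : nat :=
  \prod_(p <- primes n) (p ^ logn p n - 1).

Definition Sf (f : nat -> nat) (n : nat) : nat :=
  \sum_(d <- divisors n) f d.

Definition f_practical (f : nat -> nat) (n : nat) : bool :=
  [forall m : 'I_(Sf f n).+1, (0 < m) ==>
     [exists D : {set 'I_n.+1},
        (D \subset [set d : 'I_n.+1 | (0 < d) && (d %| n)]) &&
        (\sum_(d in D) f d == m)]].

Definition F_count (f : nat -> nat) (N : nat) : nat :=
  count (f_practical f) (iota 1 N).

(* Main.v *)
Require Import Defs.
From mathcomp Require Import all_boot all_order all_algebra zify.
From mathcomp Require Import reals sequences exp ring lra.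
Set Implicit Arguments. Unset Strict Implicit. Unset Printing Implicit Defensive.
Import Order.TTheory GRing.Theory Num.Theory.

(** Let [m_z] be the [z]-smooth part of [n] and [S = Sf ustar]. If [n] is practical, every
    prime [p | n] satisfies [p <= S m_(p-1) + 2 <= 3 S m_(p-1)]; conversely a squarefree [n]
    whose primes satisfy [p <= m_(p-1) + 2] is practical, and then [S m = m].
    Choose the exponents of the primes independently and geometrically, so that a [z]-smooth
    [m] has weight [v_z / m] with [v_z = prod_(p <= z) (1 - 1/p)], and let [z] grow. The mean
    of [ln (3 S m_z / z)] over the chains for which [3 S m_z >= z] has held so far is
    conserved up to a bounded error: by Mertens [ln m_z] gains [ln z] on average, and a chain
    is dropped exactly when this quantity reaches 0. Hence the probability that a chain
    survives until [z], or reaches a level [Y] while alive, is of order [1 / ln z], resp.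
    [1 / ln Y].
    Upper bound: a practical [n <= N] is [M r] where [M] is the first prefix beyond
    [Y = N^(1/12)], reached at [p], and [r] has no prime factor up to [p]; the sieve bound
    [O(v_p N / M)] for the number of [r] turns the count into [N] times a crossing
    probability.
    Lower bound: for the squarefree chains started at a primorial the conservation law is an
    identity, and the whole mean has to leave through crossings of [Y], each of which carries
    at most [ln Y]. The crossing prefixes are completed by small factors and a few large
    primes. *)

(** * Arithmetic of the unitary totient *)


(** The mean potential alone does not bound survival, since a surviving chain may have potential
    close to 0. A bootstrap closes this gap: to be alive at [n], a chain needs either a large
    potential at an earlier [w], which is rare by Markov's inequality, or a new prime between [w]
    and [n], which costs a further factor on top of survival until [w]. Each direction needs the
    conservation law from one side only. Above, dropping a chain removes nonnegative potential.
    Below, a drop must lose nothing: with the integer threshold [z <= m], a chain is dropped when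
    [m] is exactly one below the new [z], hence with potential 0. The weight [v_p] attached to a
    crossing at [p] has to be traded for a count. From above it is, up to a constant, the sieve
    density of the integers without prime factors up to [p]; from below it is matched by the
    harmonic mass of the squarefree [r] built from primes beyond [p]. *)

Lemma ustar1 : ustar 1 = 1.
Proof. by rewrite /ustar big_nil. Qed.

Lemma ustar_mulX m p i : 0 < m -> prime p -> ~~ (p %| m) -> 0 < i ->
  ustar (m * p ^ i) = ustar m * (p ^ i - 1).
Proof.
move=> m0 pp pm i0; have p0 := prime_gt0 pp.
have X0 : 0 < p ^ i by rewrite expn_gt0 p0.
rewrite /ustar (perm_big (p :: primes m)) /=.
  rewrite big_cons lognM // (logn_coprime) ?prime_coprime // pfactorK // add0n mulnC.
  congr (_ * _); rewrite !big_seq; apply: eq_bigr => q qm.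
  rewrite lognM // [logn q (p ^ i)]lognX (_ : logn q p = 0) ?muln0 ?addn0 //.
  rewrite logn_prime //; case: eqP => // qp; move: qm.
  by rewrite mem_primes qp => /and3P[_ _]; rewrite (negbTE pm).
apply: uniq_perm; rewrite ?primes_uniq //=.
  by rewrite primes_uniq mem_primes (negbTE pm) !andbF.
by move=> q; rewrite in_cons primesM ?primesX ?(primes_prime pp) ?inE ?(orbC (q == p)).
Qed.

Lemma ustarX p i : prime p -> ustar (p ^ i) = if i is 0 then 1 else p ^ i - 1.
Proof.
move=> pp; case: i => [|i]; first by rewrite expn0 ustar1.
rewrite -(mul1n (p ^ _)) ustar_mulX ?ustar1 ?mul1n // dvdn1.
by case: eqP pp => // ->.
Qed.

Lemma ustar_mulXE m p i : 0 < m -> prime p -> ~~ (p %| m) ->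
  ustar (m * p ^ i) = ustar m * ustar (p ^ i).
Proof.
move=> m0 pp pm; case: i => [|i]; first by rewrite expn0 muln1 ustar1 muln1.
by rewrite ustar_mulX // ustarX.
Qed.

Lemma ustar_ge n p : 0 < n -> prime p -> p %| n -> p - 1 <= ustar n.
Proof.
move=> n0 pp pn; rewrite /ustar (big_rem p) ?mem_primes ?pp ?n0 //=.
have lp : 0 < logn p n by rewrite logn_gt0 mem_primes pp n0.
have b1 : 0 < \prod_(q <- rem p (primes n)) (q ^ logn q n - 1).
  rewrite big_seq_cond; apply: prodn_cond_gt0 => q; rewrite andbT => /mem_rem.
  move=> qn; have lq : 0 < logn q n by rewrite logn_gt0.
  move: qn; rewrite mem_primes => /and3P[qp _ _].
  by rewrite subn_gt0 -[1](expn0 q) ltn_exp2l // prime_gt1.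
apply: leq_trans (leq_pmulr _ b1); apply: leq_sub2r.
by rewrite -{1}[p]expn1 leq_exp2l // prime_gt1.
Qed.

Lemma divisors_mulX m p k : 0 < m -> prime p -> ~~ (p %| m) ->
  perm_eq (divisors (m * p ^ k)) [seq d * p ^ i | d <- divisors m, i <- iota 0 k.+1].
Proof.
move=> m0 pp pm; have p0 := prime_gt0 pp.
have n0 : 0 < m * p ^ k by rewrite muln_gt0 m0 expn_gt0 p0.
have pX d : d \in divisors m -> logn p d = 0.
  rewrite -dvdn_divisors // => dm; rewrite logn_coprime // prime_coprime //.
  by apply: contra pm => /dvdn_trans; apply.
apply: uniq_perm; first exact: divisors_uniq.
  apply: allpairs_uniq; rewrite ?divisors_uniq ?iota_uniq //.
  move=> x y /allpairsP[[d' i'] [dm _ ->]] /allpairsP[[e' j'] [em _ ->]] /= E.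
  rewrite /= in dm em.
  have d0 : 0 < d' by move: dm; rewrite -dvdn_divisors // => /dvdn_gt0; apply.
  have e0 : 0 < e' by move: em; rewrite -dvdn_divisors // => /dvdn_gt0; apply.
  have Eij : i' = j'.
    have:= congr1 (logn p) E.
    by rewrite !lognM ?expn_gt0 ?p0 // !pfactorK // pX // pX.
  by move: E; rewrite Eij => /eqP; rewrite eqn_pmul2r ?expn_gt0 ?p0 // => /eqP ->.
move=> d; rewrite -dvdn_divisors //; apply/idP/allpairsP => [dn|[[e i] [em ik ->]]].
  have d0 : 0 < d := dvdn_gt0 n0 dn.
  exists (d`_p^', logn p d); split; last by rewrite /= -p_part mulnC partnC.
    rewrite -dvdn_divisors //; have := partn_dvd p^' n0 dn.
    rewrite partnM ?expn_gt0 ?p0 // [X in _ * X]part_p'nat ?muln1; last first.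
      by rewrite pnatNK pnatX pnat_id.
    move/dvdn_trans; apply; exact: dvdn_part.
  rewrite mem_iota /= add0n ltnS; have := dvdn_leq_log p n0 dn.
  by rewrite lognM ?expn_gt0 ?p0 // (pX m) ?pfactorK // -dvdn_divisors.
move: ik; rewrite mem_iota /= add0n ltnS => ik.
by move: em => /=; rewrite -dvdn_divisors // => em; apply: dvdn_mul => //; apply: dvdn_exp2l.
Qed.

(** For prime [p] this is [Sf ustar (p ^ k)]. At [k = 1] it is [1 + (p - 1) = p], the reason why
    [Sf ustar m = m] for squarefree [m]. *)
Definition St p k := \sum_(i <- iota 0 k.+1) ustar (p ^ i).

Lemma Sf_mulX m p k : 0 < m -> prime p -> ~~ (p %| m) ->
  Sf ustar (m * p ^ k) = Sf ustar m * St p k.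
Proof.
move=> m0 pp pm; rewrite /Sf (perm_big _ (divisors_mulX k m0 pp pm)) big_allpairs_dep /St.
rewrite big_distrl /= big_seq [RHS]big_seq; apply: eq_bigr => d.
rewrite -dvdn_divisors // => dm; rewrite big_distrr /=; apply: eq_bigr => i _.
apply: ustar_mulXE => //; first exact: dvdn_gt0 dm.
by apply: contra pm => /dvdn_trans; apply.
Qed.

Lemma Sf1 : Sf ustar 1 = 1.
Proof. by rewrite /Sf big_seq1 ustar1. Qed.

Lemma St0 p : St p 0 = 1.
Proof. by rewrite /St big_seq1 expn0 ustar1. Qed.

Lemma StS p k : prime p -> St p k.+1 = St p k + (p ^ k.+1 - 1).
Proof.
move=> pp; rewrite /St -[X in iota 0 X]addn1 iotaD big_cat /= big_seq1 add0n.
by rewrite [ustar (p ^ k.+1)]ustarX.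
Qed.

Lemma St1 p : prime p -> St p 1 = p.
Proof. by move=> pp; rewrite StS // St0 expn1; have := prime_gt0 pp; lia. Qed.

Lemma St_ge p k : prime p -> p ^ k <= St p k.
Proof.
move=> pp; have p0 := prime_gt0 pp; elim: k => [|k IH]; first by rewrite St0.
rewrite StS //; have : 0 < p ^ k by rewrite expn_gt0 p0.
have : 0 < p ^ k.+1 by rewrite expn_gt0 p0.
lia.
Qed.

Lemma St_le p k : prime p -> St p k <= p ^ k.+1.
Proof.
move=> pp; have p1 := prime_gt1 pp; elim: k => [|k IH]; first by rewrite St0 expn1 ltnW.
rewrite StS // (expnS p k.+1).
have : 2 * p ^ k.+1 <= p * p ^ k.+1 by rewrite leq_mul2r p1 orbT.
lia.
Qed.

Lemma Sf_mulp m p : 0 < m -> prime p -> ~~ (p %| m) -> Sf ustar (m * p) = Sf ustar m * p.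
Proof. by move=> m0 pp pm; rewrite -{1}[p]expn1 Sf_mulX // St1. Qed.

(** * Practical numbers and the adjunction of a prime *)

Definition representable f n t :=
  exists s : seq nat, [/\ uniq s, {subset s <= divisors n} & \sum_(d <- s) f d = t].

Lemma f_practicalP f n : 0 < n ->
  reflect (forall t, t <= Sf f n -> representable f n t) (f_practical f n).
Proof.
move=> n0; apply: (iffP forallP) => [H t tS|H t].
  case: (posnP t) => [->|t0]; first by exists [::]; split=> //; rewrite big_nil.
  have ht : t < (Sf f n).+1 by [].
  have /implyP /(_ t0) /existsP [D /andP[sD /eqP sumD]] := H (Ordinal ht).
  exists [seq val d | d <- enum D]; split.
  - by rewrite map_inj_uniq ?enum_uniq //; exact: val_inj.
  - move=> d /mapP[e]; rewrite mem_enum => eD ->.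
    by rewrite -dvdn_divisors //; have := subsetP sD e eD; rewrite inE => /andP[].
  - by rewrite big_map big_enum.
apply/implyP => t0; have [s [us ss sums]] := H t (ltn_ord t).
apply/existsP; exists [set d : 'I_n.+1 | val d \in s]; apply/andP; split.
  apply/subsetP => d; rewrite !inE => /ss; rewrite -dvdn_divisors // => dn.
  by rewrite dn andbT; exact: dvdn_gt0 dn.
rewrite -sums; apply/eqP.
have sn d : d \in s -> d < n.+1.
  by move/ss; rewrite -dvdn_divisors // => /dvdn_leq; rewrite ltnS; apply.
rewrite (eq_bigl (fun d : 'I_n.+1 => val d \in s)); last by move=> d; rewrite inE.
rewrite -(big_mkord (mem s)) -big_filter; apply: perm_big; apply: uniq_perm => //.
  by rewrite filter_uniq // /index_iota iota_uniq.
move=> d; rewrite mem_filter mem_index_iota /=; case: (boolP (d \in s)) => //= /sn.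
by [].
Qed.

(** Every [t] is split as [a + (p - 1) * b] with [a, b <= S]: since [p - 1 <= S + 1], the intervals
    of length [S] starting at the multiples of [p - 1] leave no gap. Divisors of [m] represent [a];
    those representing [b] are multiplied by [p]. *)
Lemma practical_mul m p : 0 < m -> prime p -> ~~ (p %| m) -> p <= Sf ustar m + 2 ->
  f_practical ustar m -> f_practical ustar (m * p).
Proof.
move=> m0 pp pm pS /(f_practicalP _ m0) H; have p1 := prime_gt1 pp.
apply/f_practicalP; first by rewrite muln_gt0 m0 prime_gt0.
move=> t; rewrite Sf_mulp // => tS.
set S := Sf ustar m in H pS tS.
(* [b] is the quotient of [t] by [p - 1], capped at [S]. *)
have [b [bS aS bt]] : exists b, [/\ b <= S, t - (p - 1) * b <= S & (p - 1) * b <= t].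
  have h : t <= (p - 1) * S + S by rewrite -{2}[S]mul1n -mulnDl subnK ?(ltnW p1) // mulnC.
  have q0 : 0 < p - 1 by rewrite subn_gt0.
  have E := divn_eq t (p - 1); have L := ltn_pmod t q0.
  have [hb|hb] := leqP (t %/ (p - 1)) S; first by exists (t %/ (p - 1)); split; lia.
  exists S; split; nia.
have [s1 [u1 ss1 sum1]] := H _ aS; have [s2 [u2 ss2 sum2]] := H _ bS.
have dm d : d \in divisors m -> [/\ 0 < d, ~~ (p %| d) & d %| m].
  rewrite -dvdn_divisors // => dm; split=> //; first exact: dvdn_gt0 dm.
  by apply: contra pm => /dvdn_trans; apply.
exists (s1 ++ [seq d * p | d <- s2]); split.
- rewrite cat_uniq u1 map_inj_uniq ?u2 ?andbT; last first.
    by move=> x y /eqP; rewrite eqn_pmul2r ?prime_gt0 // => /eqP.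
  apply/hasPn => x /mapP[d ds2 ->]; apply/negP => /ss1/dm[_ + _].
  by rewrite dvdn_mull.
- move=> x; rewrite mem_cat -dvdn_divisors ?muln_gt0 ?m0 ?prime_gt0 //.
  case/orP => [/ss1/dm[_ _ xm]|/mapP[d /ss2/dm[_ _ xm] ->]].
    by rewrite dvdn_mulr.
  by rewrite dvdn_mul.
rewrite big_cat big_map /= sum1.
rewrite (_ : \sum_(_ <- s2) _ = (p - 1) * b); first by rewrite subnK.
rewrite -sum2 big_distrr /= big_seq [RHS]big_seq; apply: eq_bigr => d /ss2/dm[d0 pd _].
by rewrite -{1}[p]expn1 ustar_mulX // expn1 mulnC.
Qed.

(* The primes up to [z], so that [n`_(sm z)] is the [z]-smooth part of [n]. *)
Definition sm z : nat_pred := [pred q | q <= z].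

Lemma smS z n : 0 < n ->
  n`_(sm z.+1) = n`_(sm z) * (if prime z.+1 then z.+1 ^ logn z.+1 n else 1).
Proof.
move=> n0; set b := maxn n z.+1.
have nb : n <= b by rewrite leq_maxl.
rewrite !(widen_partn _ nb).
rewrite big_mkcond (bigD1_seq z.+1) ?iota_uniq ?mem_index_iota ?ltnS ?leq_maxr //=.
rewrite [in RHS]big_mkcond [in RHS](bigD1_seq z.+1) ?iota_uniq ?mem_index_iota ?ltnS ?leq_maxr //=.
rewrite !inE leqnn ltnn mul1n mulnC; congr (_ * _); last by rewrite lognE; case: prime.
apply: eq_bigr => q qz; rewrite !inE; congr (if _ then _ else _).
by rewrite leq_eqVlt (negbTE qz).
Qed.

Lemma sm0 n : n`_(sm 0) = 1.
Proof.
rewrite /partn big1 // => q; rewrite inE leqn0 => /eqP ->.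
by rewrite lognE.
Qed.

Lemma sm_big z n : 0 < n -> n <= z -> n`_(sm z) = n.
Proof.
move=> n0 nz; apply: part_pnat_id; apply/pnatP => // p pp pn; rewrite inE.
exact: leq_trans (dvdn_leq n0 pn) nz.
Qed.

(* p - 2 must be represented, and only divisors built from primes below p have value below p - 1. *)
Lemma practical_prime_le n p : 0 < n -> f_practical ustar n -> prime p -> p %| n ->
  p <= Sf ustar (n`_(sm p.-1)) + 2.
Proof.
move=> n0 /(f_practicalP _ n0) H pp pn; have p1 := prime_gt1 pp.
have : p - 2 <= Sf ustar n.
  apply: leq_trans (_ : p - 1 <= _); first lia.
  rewrite /Sf (big_rem p) /=; last by rewrite -dvdn_divisors.
  by apply: leq_trans (leq_addr _ _); apply: ustar_ge => //; exact: prime_gt0.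
case/H => s [us ss sums].
suff : p - 2 <= Sf ustar (n`_(sm p.-1)) by lia.
rewrite -sums /Sf; set m := n`_ _.
have sd : {subset s <= divisors m}.
  move=> d ds; have := ss d ds; rewrite -!dvdn_divisors // ?part_gt0 // => dn.
  have d0 : 0 < d := dvdn_gt0 n0 dn.
  have dlt : ustar d <= p - 2.
    by rewrite -sums (big_rem d) //= leq_addr.
  have dp : (sm p.-1).-nat d.
    apply/pnatP => // q qp qd; rewrite inE; have := ustar_ge d0 qp qd; lia.
  by rewrite -(part_pnat_id dp) partn_dvd.
have -> : \sum_(d <- divisors m) ustar d = \sum_(d <- s) ustar d + \sum_(d <- [seq d <- divisors m | d \notin s]) ustar d.
  rewrite -big_cat; apply: perm_big; apply: uniq_perm; rewrite ?divisors_uniq //.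
    rewrite cat_uniq us filter_uniq ?divisors_uniq // andbT.
    by apply/hasPn => x; rewrite mem_filter => /andP[].
  move=> x; rewrite mem_cat mem_filter; case: (boolP (x \in s)) => //= /sd //.
by rewrite leq_addr.
Qed.

(** * Chebyshev and Mertens bounds *)

Lemma prod_primes_dvd (s : seq nat) n : uniq s -> all prime s -> all (dvdn^~ n) s ->
  \prod_(p <- s) p %| n.
Proof.
elim: s n => [|p s IH] n /=; first by rewrite big_nil dvd1n.
case/andP=> ps us /andP[pp sp] /andP[pn sn]; rewrite big_cons Gauss_dvd ?pn ?IH //.
rewrite prime_coprime //; apply/negP => pd.
have : has (dvdn p) s.
  elim: s sp pd {IH ps us sn} => [|q s IH] /=; first by rewrite big_nil Euclid_dvd1.
  case/andP=> qp sp; rewrite big_cons Euclid_dvdM // => /orP[->//|/IH -> //].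
  by rewrite orbT.
case/hasP => q qs; rewrite dvdn_prime2 ?(allP sp q qs) // => /eqP pq.
by rewrite pq qs in ps.
Qed.

(** The two middle coefficients of row [2m + 1] are equal and together at most [2 ^ (2m + 1)]. *)
Lemma bin_odd_mid_le m : 'C(m.*2.+1, m) <= 4 ^ m.
Proof.
have h : 'C(m.*2.+1, m) + 'C(m.*2.+1, m.+1) <= 2 ^ m.*2.+1.
  rewrite -[2]/(1 + 1) expnDn.
  have lt1 : m < m.*2.+2 by lia.
  have lt2 : m.+1 < m.*2.+2 by lia.
  rewrite (bigD1 (Ordinal lt1)) //= (bigD1 (Ordinal lt2)) /=; last first.
    by apply/eqP => /(congr1 val) /=; lia.
  by rewrite !exp1n !muln1 addnA leq_addr.
have e : 'C(m.*2.+1, m.+1) = 'C(m.*2.+1, m).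
  by rewrite -bin_sub; [congr 'C(_, _); lia|lia].
have e4 : 2 ^ m.*2.+1 = 2 * 4 ^ m by rewrite expnS -mul2n expnM.
by move: h; rewrite e e4; lia.
Qed.

Lemma prime_dvd_fact p n : prime p -> p %| n`! -> p <= n.
Proof.
move=> pp; elim: n => [|n IH]; first by rewrite fact0 Euclid_dvd1.
by rewrite factS Euclid_dvdM // => /orP[/dvdn_leq -> //|/IH/leq_trans -> //].
Qed.

(** Induction: an even [n > 2] adds no prime, and for [n = 2m + 1] the primes in [(m + 1, n]] all
    divide ['C(n, m)]. *)
Lemma primorial_le n : \prod_(0 <= p < n.+1 | prime p) p <= 4 ^ n.
Proof.
elim/ltn_ind: n => n IH.
case: (ltnP n 3) => n3; first by case: n n3 {IH} => [|[|[|]]] // _; rewrite unlock.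
have [m [en|en]] : exists m, n = m.*2 \/ n = m.*2.+1.
  by exists n./2; have := odd_double_half n; case: odd => /=; [right|left]; lia.
- rewrite big_mkcond big_nat_recr //= -big_mkcond.
  have -> : prime n = false.
    apply/negP => /primeP[_ /(_ 2)]; rewrite en dvdn2 odd_double => /(_ isT) /orP[]; lia.
  rewrite muln1; have -> : n = n.-1.+1 by lia.
  apply: leq_trans (IH n.-1 _) _; first lia.
  by rewrite leq_exp2l //; lia.
have m1 : m.+1 < n.+1 by lia.
rewrite (@big_cat_nat _ _ _ m.+2) //=.
have -> : 4 ^ n = 4 ^ m.+1 * 4 ^ m by rewrite -expnD; congr (_ ^ _); lia.
apply: leq_mul; first by apply: IH; lia.
apply: leq_trans (bin_odd_mid_le m); apply: dvdn_leq; first by rewrite bin_gt0; lia.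
rewrite -big_filter; apply: prod_primes_dvd.
- by rewrite filter_uniq // iota_uniq.
- by apply/allP => p; rewrite mem_filter => /andP[].
apply/allP => p; rewrite mem_filter mem_index_iota => /andP[pp /andP[pl pu]].
have := bin_fact (_ : m <= m.*2.+1); rewrite (_ : m.*2.+1 - m = m.+1); last lia.
move=> /(_ (ltac:(lia))) E.
have : p %| (m.*2.+1)`! by apply: dvdn_fact; rewrite prime_gt0 //=; lia.
rewrite -E Euclid_dvdM // => /orP[//|].
by rewrite Euclid_dvdM // => /orP[] /(prime_dvd_fact pp); lia.
Qed.

Ltac neq0_lra := repeat (apply/andP; split); rewrite ?gt_eqF //; lra.

Section LogNat.
Variable R : realType.
Local Open Scope ring_scope.

Definition lnnat (n : nat) : R := ln n%:R.
Local Notation lnn := lnnat.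

Lemma lnn1 : lnn 1 = 0. Proof. by rewrite /lnnat ln1. Qed.

Lemma lnn_ge0 n : 0 <= lnn n.
Proof.
case: n => [|n]; first by rewrite /lnnat ln0.
by apply: ln_ge0; rewrite ler1n.
Qed.

Lemma lnnM m n : (0 < m)%N -> (0 < n)%N -> lnn (m * n) = lnn m + lnn n.
Proof. by move=> m0 n0; rewrite /lnnat natrM lnM // posrE ltr0n. Qed.

Lemma lnn_le m n : (m <= n)%N -> lnn m <= lnn n.
Proof.
case: m => [|m] mn; first by rewrite {1}/lnnat ln0 // lnn_ge0.
by rewrite /lnnat ler_ln ?posrE ?ltr0n ?ler_nat // (leq_trans _ mn).
Qed.

Lemma lnnX m k : (0 < m)%N -> lnn (m ^ k) = k%:R * lnn m.
Proof. by move=> m0; rewrite /lnnat natrX lnXn ?ltr0n // mulr_natl. Qed.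

Lemma lnnS_le n : (0 < n)%N -> lnn n.+1 - lnn n <= n%:R^-1.
Proof.
move=> n0; have n0' : 0 < n%:R :> R by rewrite ltr0n.
rewrite /lnnat -ln_div ?posrE ?ltr0n //.
have -> : n.+1%:R / n%:R = 1 + n%:R^-1 :> R by rewrite -natr1; field; rewrite gt_eqF.
by apply: le_ln1Dx; apply: lt_trans (_ : 0 < _); rewrite ?invr_gt0 // ltrN10.
Qed.

Lemma lnnS_ge n : (0 < n)%N -> n.+1%:R^-1 <= lnn n.+1 - lnn n.
Proof.
move=> n0; have n0' : 0 < n%:R :> R by rewrite ltr0n.
have h : 0 < n%:R + 1 :> R by lra.
rewrite -lerN2 opprB /lnnat -ln_div ?posrE ?ltr0n //.
have -> : n%:R / n.+1%:R = 1 + (- n.+1%:R^-1) :> R by rewrite -natr1; field; rewrite gt_eqF.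
apply: le_ln1Dx; rewrite ltrN2 invf_lt1 ?ltr1n ?ltr0n //.
Qed.

Lemma lnn2_ge : 2^-1 <= lnn 2.
Proof. by have := @lnnS_ge 1 isT; rewrite lnn1 subr0. Qed.

Lemma lnn_ge_half n : (1 < n)%N -> 2^-1 <= lnn n.
Proof. by move=> n1; apply: le_trans lnn2_ge _; apply: lnn_le. Qed.

Lemma lnn_gt0 n : (1 < n)%N -> 0 < lnn n.
Proof. by move/lnn_ge_half; apply: lt_le_trans; lra. Qed.

Lemma lnn2_le : lnn 2 <= 1.
Proof. by have := @lnnS_le 1 isT; rewrite lnn1 subr0 invr1. Qed.

Lemma lnn_le_nat n : lnn n <= n%:R.
Proof.
elim: n => [|n IH]; first by rewrite /lnnat ln0.
case: n IH => [|n] IH; first by rewrite lnn1.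
have h : lnn n.+2 - lnn n.+1 <= 1.
  by apply: le_trans (@lnnS_le n.+1 isT) _; rewrite invf_le1 ?ltr0n // ler1n.
by rewrite -[n.+2%:R]natr1; move: IH h; lra.
Qed.

(* The terms are dominated by the differences of [- (ln k + 2) / k]. *)
Lemma sum_ln_sq_le n : \sum_(2 <= k < n.+1) lnn k / (k%:R * (k%:R - 1)) <= 2.
Proof.
case: n => [|n]; first by rewrite big_geq.
suff : \sum_(2 <= k < n.+2) lnn k / (k%:R * (k%:R - 1)) <= 2 - (lnn n.+1 + 2) / n.+1%:R.
  move/le_trans; apply; rewrite gerBl divr_ge0 // ?ler0n // addr_ge0 ?lnn_ge0 //.
elim: n => [|n IH]; first by rewrite big_geq // lnn1; lra.
rewrite big_nat_recr //=; apply: le_trans (lerD IH (lexx _)) _.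
have n1 : 0 < n.+1%:R :> R by rewrite ltr0n.
have n2 : 0 < n.+1%:R + 1 :> R by lra.
have h : n.+1%:R * (lnn n.+2 - lnn n.+1) <= 1.
  by rewrite mulrC -ler_pdivlMr // mul1r lnnS_le.
have h2 := lnnS_ge (ltn0Sn n).
have h3 : lnn n.+2 - lnn n.+1 <= 1.
  apply: le_trans (lnnS_le (ltn0Sn n)) _; by rewrite invf_le1 // ler1n.
rewrite -[n.+2%:R]natr1 addrK -subr_ge0.
have -> : 2 - (lnn n.+2 + 2) / (n.+1%:R + 1) -
  (2 - (lnn n.+1 + 2) / n.+1%:R + lnn n.+2 / ((n.+1%:R + 1) * n.+1%:R)) =
  (2 - n.+1%:R * (lnn n.+2 - lnn n.+1) - (lnn n.+2 - lnn n.+1)) / ((n.+1%:R + 1) * n.+1%:R).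
  by have n0 : 0 <= n%:R :> R by []; field; neq0_lra.
by apply: divr_ge0; [lra|rewrite mulr_ge0 // ltW].
Qed.

Definition psum (F : nat -> R) n := \sum_(0 <= p < n.+1 | prime p) F p.

Lemma psumS F n : psum F n.+1 = psum F n + (if prime n.+1 then F n.+1 else 0).
Proof. by rewrite /psum big_mkcond big_nat_recr //= -big_mkcond. Qed.

Lemma psum0 F : psum F 0 = 0.
Proof. by rewrite /psum big_mkcond big_nat1. Qed.

Lemma psum1 F : psum F 1 = 0.
Proof. by rewrite psumS psum0 /= addr0. Qed.

Lemma le_psum F G n : (forall p, prime p -> (p <= n)%N -> F p <= G p) -> psum F n <= psum G n.
Proof.
move=> H; rewrite /psum big_nat_cond [leRHS]big_nat_cond; apply: ler_sum => p.
by case/andP => /andP[_ pn] pp; apply: H.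
Qed.

Lemma psum_ge0 F n : (forall p, prime p -> (p <= n)%N -> 0 <= F p) -> 0 <= psum F n.
Proof.
move=> H; rewrite /psum big_nat_cond; apply: sumr_ge0 => p.
by case/andP => /andP[_ pn] pp; apply: H.
Qed.

Lemma psumD F G n : psum (fun p => F p + G p) n = psum F n + psum G n.
Proof. by rewrite /psum big_split. Qed.

Lemma psumZ a F n : psum (fun p => a * F p) n = a * psum F n.
Proof. by rewrite /psum mulr_sumr. Qed.

Lemma lnn_factor n z : (0 < n)%N -> (forall p, prime p -> (p %| n)%N -> (p <= z)%N) ->
  lnn n = psum (fun p => (logn p n)%:R * lnn p) z.
Proof.
move=> n0 H; have {1}<- : (n`_(sm z))%N = n.
  by apply: part_pnat_id; apply/pnatP => // p pp pn; rewrite inE; apply: H.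
elim: z {H} => [|z IH]; first by rewrite sm0 lnn1 psum0.
rewrite smS // psumS -IH; case: ifP => pz; last by rewrite muln1 addr0.
by rewrite lnnM ?part_gt0 ?pfactor_gt0 // lnnX.
Qed.

Lemma psum_ln_sq_le n : psum (fun p => lnn p / (p%:R * (p%:R - 1))) n <= 2.
Proof.
apply: le_trans (sum_ln_sq_le n); case: n => [|n]; first by rewrite psum0 big_geq.
elim: n => [|n IH]; first by rewrite psum1 big_geq.
rewrite psumS big_nat_recr //=; apply: lerD IH _.
case: ifP => // _; apply: divr_ge0; first exact: lnn_ge0.
by rewrite mulr_ge0 // subr_ge0 ler1n.
Qed.

Lemma chebyshev_theta_le n : psum lnn n <= 2 * n%:R.
Proof.
have -> : psum lnn n = lnn (\prod_(0 <= p < n.+1 | prime p) p).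
  elim: n => [|n IH]; first by rewrite psum0 big_mkcond big_nat1 lnn1.
  rewrite psumS IH [in RHS]big_mkcond big_nat_recr //= -big_mkcond.
  case: ifP => pn; last by rewrite muln1 addr0.
  by rewrite lnnM //; apply: prodn_cond_gt0 => p; exact: prime_gt0.
apply: le_trans (lnn_le (primorial_le n)) _.
rewrite lnnX // (_ : 4 = 2 ^ 2)%N // lnnX // mulrC ler_wpM2r ?ler0n //.
by have := lnn2_le; lra.
Qed.

Lemma ln_fact_le n : lnn n`! <= n%:R * lnn n.
Proof.
elim: n => [|n IH]; first by rewrite fact0 lnn1 mul0r.
rewrite factS lnnM ?fact_gt0 // -natr1 mulrDl mul1r addrC lerD2r.
apply: le_trans IH _; rewrite ler_wpM2l ?ler0n //; exact: lnn_le.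
Qed.

Lemma ln_fact_ge n : n%:R * lnn n - n%:R <= lnn n`!.
Proof.
elim: n => [|n IH]; first by rewrite fact0 lnn1 mul0r subr0.
rewrite factS lnnM ?fact_gt0 // -natr1.
have h : n%:R * (lnn n.+1 - lnn n) <= 1.
  case: n {IH} => [|n]; first by rewrite mul0r.
  by rewrite mulrC -ler_pdivlMr ?ltr0n // mul1r lnnS_le.
lra.
Qed.

Lemma geo_sum_le (x : R) n : 0 <= x -> x < 1 -> \sum_(1 <= k < n.+1) x ^+ k <= x / (1 - x).
Proof.
move=> x0 x1; have h : 0 < 1 - x by lra.
suff -> : \sum_(1 <= k < n.+1) x ^+ k = (x - x ^+ n.+1) / (1 - x).
  by rewrite ler_pM2r ?invr_gt0 // gerBl exprn_ge0.
elim: n => [|n IH]; first by rewrite big_geq // expr1 subrr mul0r.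
by rewrite big_nat_recr //= IH !exprS; field; rewrite gt_eqF.
Qed.

(** * Mertens' first theorem with explicit constants *)

Definition mert n := psum (fun p => lnn p / p%:R) n.

Lemma natr_div_le m d : (m %/ d)%:R <= m%:R / d%:R :> R.
Proof.
case: (posnP d) => [->|d0]; first by rewrite divn0 invr0 mulr0.
by rewrite ler_pdivlMr ?ltr0n // -natrM ler_nat leq_divM.
Qed.

(** By Legendre's formula [p] has exponent at most [n / (p - 1)] in [n!]. Writing
    [1 / (p - 1) = 1 / p + 1 / (p (p - 1))] isolates [mert]; the lower bound for [ln n!] costs 1 and
    the second sum costs 2. *)
Lemma mert_ge n : (0 < n)%N -> lnn n - 3 <= mert n.
Proof.
move=> n0; have n0' : 0 < n%:R :> R by rewrite ltr0n.
have h := ln_fact_ge n.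
have h2 : lnn n`! <= n%:R * psum (fun p => lnn p / p%:R + lnn p / (p%:R * (p%:R - 1))) n.
  rewrite (@lnn_factor _ n) ?fact_gt0 //; last by move=> p pp /(prime_dvd_fact pp).
  rewrite -psumZ; apply: le_psum => p pp pn.
  have p1 : 1 < p%:R :> R by rewrite ltr1n prime_gt1.
  have -> : lnn p / p%:R + lnn p / (p%:R * (p%:R - 1)) = (p%:R - 1)^-1 * lnn p.
    by field; rewrite !gt_eqF //; lra.
  rewrite mulrA ler_wpM2r ?lnn_ge0 // logn_fact // natr_sum.
  have -> : (p%:R - 1)^-1 = p%:R^-1 / (1 - p%:R^-1) :> R by field; rewrite !gt_eqF //; lra.
  apply: le_trans (_ : n%:R * \sum_(1 <= k < n.+1) (p%:R^-1) ^+ k <= _).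
    rewrite mulr_sumr; apply: ler_sum => k _; apply: le_trans (natr_div_le _ _) _.
    by rewrite natrX exprVn.
  rewrite ler_wpM2l ?ler0n //; apply: geo_sum_le; first by rewrite invr_ge0 ler0n.
  by rewrite invf_lt1 //; lra.
have h3 : n%:R * (lnn n - 1) <= n%:R * psum (fun p => lnn p / p%:R + lnn p / (p%:R * (p%:R - 1))) n.
  by apply: le_trans h2; rewrite mulrBr mulr1.
move: h3; rewrite ler_pM2l // psumD; have := psum_ln_sq_le n; rewrite /mert; lra.
Qed.

(** Only the first term [n %/ p >= n / p - 1] of Legendre's formula is kept; the rounding costs the
    Chebyshev sum [psum lnn n <= 2 n]. *)
Lemma mert_le n : mert n <= lnn n + 2.
Proof.
case: n => [|n]; first by rewrite /mert psum0 addr_ge0 // lnn_ge0.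
set N := n.+1; have n0' : 0 < N%:R :> R by rewrite ltr0n.
have h2 : psum (fun p => N%:R * (lnn p / p%:R) + (-1) * lnn p) N <= lnn N`!.
  rewrite (@lnn_factor N`! N) ?fact_gt0 //; last by move=> p pp /(prime_dvd_fact pp).
  apply: le_psum => p pp pn; have p0 : 0 < p%:R :> R by rewrite ltr0n prime_gt0.
  have -> : N%:R * (lnn p / p%:R) + (-1) * lnn p = (N%:R / p%:R - 1) * lnn p by ring.
  rewrite ler_wpM2r ?lnn_ge0 // logn_fact // big_ltn //= expn1 natrD.
  apply: le_trans (_ : (N %/ p)%:R <= _); last by rewrite lerDl ler0n.
  rewrite lerBlDr natr1 ler_pdivrMr // -natrM ler_nat.
  by rewrite {1}(divn_eq N p) mulSn addnC leq_add2r ltnW // ltn_pmod // prime_gt0.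
have h3 : N%:R * mert N <= N%:R * (lnn N + 2).
  move: h2; rewrite psumD !psumZ -/(mert N) => h2.
  have := ln_fact_le N; have := chebyshev_theta_le N; rewrite mulrDr [N%:R * 2]mulrC; lra.
by move: h3; rewrite ler_pM2l.
Qed.

Lemma mert_diff_le w z : (0 < w)%N -> mert z - mert w <= lnn z - lnn w + 5.
Proof. by move=> w0; have := mert_le z; have := mert_ge w0; lra. Qed.

Lemma mert_diff_ge w z : (0 < z)%N -> lnn z - lnn w - 5 <= mert z - mert w.
Proof. by move=> z0; have := mert_le w; have := mert_ge z0; lra. Qed.

End LogNat.

(** * A sieve upper bound *)

Section Sieve.
Variable R : realType.
Local Open Scope ring_scope.
Local Notation lnn := (lnnat R).

(** Repetitions in [s2] only increase the right side, so a list that covers [s1] needs no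
    disjointness. *)
Lemma sum_cover (T : eqType) (F : T -> R) (s1 s2 : seq T) : uniq s1 -> {subset s1 <= s2} ->
  (forall t, t \in s2 -> 0 <= F t) -> \sum_(t <- s1) F t <= \sum_(t <- s2) F t.
Proof.
elim: s1 s2 => [|x s1 IH] s2 /=.
  by move=> _ _ F0; rewrite big_nil big_seq; apply: sumr_ge0 => t /F0.
case/andP => xs us sub F0; have xs2 : x \in s2 by apply: sub; rewrite mem_head.
rewrite big_cons (big_rem _ xs2) /= lerD2l; apply: IH => //; last first.
  by move=> t /mem_rem /F0.
move=> t ts; have ts2 : t \in s2 by apply: sub; rewrite in_cons ts orbT.
have := perm_mem (perm_to_rem xs2) t; rewrite ts2 in_cons; case: eqP => [tx|_] //=.
by rewrite -tx ts in xs.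
Qed.

(** Summation by parts: an upper bound for the partial sums of [d], whose terms may have either
    sign, passes to the sum with nonincreasing weights. *)
Lemma abel_le (u d : nat -> R) (a n : nat) (B : R) :
  (forall k, (a <= k)%N -> 0 <= u k) -> (forall k, (a <= k)%N -> u k.+1 <= u k) ->
  (forall k, (a <= k <= n)%N -> \sum_(a <= i < k.+1) d i <= B) -> 0 <= B ->
  \sum_(a <= k < n.+1) u k * d k <= u a * B.
Proof.
move=> u0 umono hB B0; case: (ltnP n a) => [na|an].
  by rewrite big_geq //; apply: mulr_ge0 => //; apply: u0.
(* The unspent allowance, [B] minus the partial sum, is carried along at the current weight. *)
suff H j : (a + j <= n)%N -> \sum_(a <= k < (a + j).+1) u k * d k +
    u (a + j)%N * (B - \sum_(a <= k < (a + j).+1) d k) <= u a * B.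
  have := H (n - a)%N; rewrite subnKC // => /(_ (leqnn _)); apply: le_trans.
  rewrite lerDl mulr_ge0 ?u0 // subr_ge0 hB // an leqnn //.
elim: j => [|j IH] ajn; first by rewrite addn0 !big_nat1; lra.
rewrite addnS !(@big_nat_recr _ _ _ (a + j).+1) /=; try lia.
apply: le_trans (IH _); last lia.
set S1 := \sum_(_ <= _ < _) _; set S2 := \sum_(_ <= _ < _) _.
have h : u (a + j).+1 * (B - S2) <= u (a + j)%N * (B - S2).
  apply: ler_wpM2r; last by apply: umono; rewrite leq_addr.
  by rewrite subr_ge0 hB // leq_addr /=; lia.
lra.
Qed.

(** * The Euler product over the primes up to [z] *)

Definition vprod z : R := \prod_(0 <= p < z.+1 | prime p) (1 - p%:R^-1).

Lemma vprodS z : vprod z.+1 = vprod z * (if prime z.+1 then 1 - z.+1%:R^-1 else 1).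
Proof. by rewrite /vprod big_mkcond big_nat_recr //= -big_mkcond. Qed.

Lemma vprod0 : vprod 0 = 1.
Proof. by rewrite /vprod big_mkcond big_nat1. Qed.

Lemma vprod1 : vprod 1 = 1.
Proof. by rewrite vprodS vprod0 mul1r. Qed.

Lemma primeV_le p : prime p -> p%:R^-1 <= 2^-1 :> R.
Proof. by move=> pp; rewrite lef_pV2 ?posrE ?ltr0n ?ler_nat ?prime_gt1 ?prime_gt0. Qed.

Lemma primeV_gt0 p : prime p -> 0 < p%:R^-1 :> R.
Proof. by move=> pp; rewrite invr_gt0 ltr0n prime_gt0. Qed.

Lemma euler_factor_gt0 p : prime p -> 0 < 1 - p%:R^-1 :> R.
Proof. by move=> pp; have := primeV_le pp; set t := _^-1; lra. Qed.

Lemma euler_factor_le1 p : prime p -> 1 - p%:R^-1 <= 1 :> R.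
Proof. by move=> pp; rewrite gerBl ltW // primeV_gt0. Qed.

Lemma vprod_gt0 z : 0 < vprod z.
Proof.
elim: z => [|z IH]; first by rewrite vprod0.
rewrite vprodS; apply: mulr_gt0 => //; by case: ifP => // /euler_factor_gt0.
Qed.

Lemma vprod_inv_le_exp z :
  (vprod z)^-1 <= expR (psum (fun p => (p%:R - 1)^-1 : R) z).
Proof.
elim: z => [|z IH]; first by rewrite vprod0 psum0 expR0 invr1.
rewrite vprodS psumS; case: ifP => pz; last by rewrite mulr1 addr0.
rewrite expRD invfM.
have z1 : 1 < z.+1%:R :> R by rewrite ltr1n prime_gt1.
apply: ler_pM => //; rewrite ?invr_ge0 ?(ltW (vprod_gt0 z)) ?(ltW (euler_factor_gt0 pz)) //.
have -> : (1 - z.+1%:R^-1)^-1 = 1 + (z.+1%:R - 1)^-1 :> R.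
  by move: z.+1%:R z1 => x x1; field; neq0_lra.
exact: expR_ge1Dx.
Qed.

(** A discrete [ln ln n]: the term [k = 2] equals 1, and each later one is at most the increment of
    [ln (ln k)]. *)
Lemma sum_step_over_ln_le n : (1 < n)%N ->
  \sum_(2 <= k < n.+1) (lnn k)^-1 * (lnn k - lnn k.-1) <= 1 + ln (lnn n) - ln (lnn 2).
Proof.
case: n => [|[|n]] // _; elim: n => [|n IH].
  by rewrite big_nat1 lnn1 subr0 mulVf ?gt_eqF ?lnn_gt0 //; lra.
rewrite big_nat_recr //=; have a0 := @lnn_gt0 R n.+2 isT; have b0 := @lnn_gt0 R n.+3 isT.
suff : (lnn n.+3)^-1 * (lnn n.+3 - lnn n.+2) <= ln (lnn n.+3) - ln (lnn n.+2) by lra.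
rewrite mulrBr mulVf ?gt_eqF //.
rewrite -lerN2 !opprB -ln_div ?posrE // [_^-1 * _]mulrC.
have -> : lnn n.+2 / lnn n.+3 = 1 + (lnn n.+2 / lnn n.+3 - 1) by lra.
rewrite [leRHS]addrC addKr; apply: le_ln1Dx.
have : 0 < lnn n.+2 / lnn n.+3 by rewrite divr_gt0.
lra.
Qed.

Lemma psum_nat (F : nat -> R) n : psum F n = \sum_(2 <= k < n.+1) (if prime k then F k else 0).
Proof.
case: n => [|n]; first by rewrite psum0 big_geq.
elim: n => [|n IH]; first by rewrite psum1 big_geq.
by rewrite psumS IH [in RHS]big_nat_recr.
Qed.

(** Partial summation against [1 / ln k]: the sums of [ln p / (p - 1)] exceed [ln k] by at most 4,
    so the sum of [1 / (p - 1)] is at most [ln ln n + O(1)]. *)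
Lemma vprod_inv_le : exists2 C : R, 0 < C & forall n, (1 < n)%N -> (vprod n)^-1 <= C * lnn n.
Proof.
have l2 := lnn_gt0 R (isT : 1 < 2)%N.
(* [9] is 1 from the comparison sum plus 8 from [4 / ln 2 <= 8]. *)
exists (expR 9 * expR (- ln (lnn 2))); first by rewrite mulr_gt0 ?expR_gt0.
move=> n n1; apply: le_trans (vprod_inv_le_exp n) _.
have n0 := lnn_gt0 R n1.
have <- : expR (ln (lnn n)) = lnn n by rewrite lnK // posrE.
rewrite -!expRD ler_expR.
have A : \sum_(2 <= k < n.+1) (lnn k)^-1 *
    ((if prime k then lnn k / (k%:R - 1) else 0) - (lnn k - lnn k.-1)) <= (lnn 2)^-1 * 4.
  apply: (@abel_le (fun k => (lnn k)^-1) _ 2 n) => //.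
  - by move=> k _; rewrite invr_ge0 lnn_ge0.
  - move=> k k2; have k0 := lnn_gt0 R k2; rewrite lef_pV2 ?posrE ?lnn_gt0 ?lnn_le //.
    exact: leqW.
  move=> k /andP[k2 _]; rewrite sumrB -psum_nat.
  have -> : \sum_(2 <= i < k.+1) (lnn i - lnn i.-1) = lnn k.
    case: k k2 => [|[|k]] // _; elim: k => [|k IH]; first by rewrite big_nat1 lnn1 subr0.
    by rewrite big_nat_recr //= IH; lra.
  have -> : psum (fun p => lnn p / (p%:R - 1)) k =
     mert R k + psum (fun p => lnn p / (p%:R * (p%:R - 1))) k.
    rewrite /mert -psumD /psum; apply: eq_bigr => p pp.
    have p1 : 1 < p%:R :> R by rewrite ltr1n prime_gt1.
    by field; neq0_lra.
  have := psum_ln_sq_le R k; have := mert_le R k; lra.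
have B := sum_step_over_ln_le n1.
have l2h : (lnn 2)^-1 * 4 <= 8.
  by rewrite ler_pdivrMl //; have := lnn2_ge R; lra.
have -> : psum (fun p => (p%:R - 1)^-1) n =
   \sum_(2 <= k < n.+1) (lnn k)^-1 * (if prime k then lnn k / (k%:R - 1) else 0).
  rewrite psum_nat big_nat [RHS]big_nat; apply: eq_bigr => k /andP[k2 _].
  case: ifP => _; last by rewrite mulr0.
  by rewrite mulrA mulVf ?mul1r // gt_eqF // lnn_gt0.
move: A; under eq_bigr do rewrite mulrBr.
rewrite sumrB; lra.
Qed.

(* Writing [ln x = ln (x / r) + ln r] and [ln r] as a sum over the prime powers dividing [r],
   each [r = p s] is charged to its divisor [s], which again satisfies [G]. *)
Lemma hereditary_count_le (G : pred nat) x : (0 < x)%N -> G 1%N ->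
  (forall r s, (0 < r)%N -> G r -> (s %| r)%N -> G s) ->
  (\sum_(r <- iota 1 x | G r) 1) * lnn x <= 5 * x%:R * \sum_(s <- iota 1 x | G s) s%:R^-1.
Proof.
move=> x0 G1 herG; set H := \sum_(s <- iota 1 x | G s) s%:R^-1.
have x0' : 0 < x%:R :> R by rewrite ltr0n.
have H1 : 1 <= H.
  rewrite /H -(prednK x0) /= big_cons G1 invr1 lerDl.
  by apply: sumr_ge0 => s _; rewrite invr_ge0.
have iP r : r \in iota 1 x -> (0 < r <= x)%N by rewrite mem_iota add1n ltnS.
have E1 : \sum_(r <- iota 1 x | G r) (lnn x - lnn r) <= x%:R * H.
  rewrite mulr_sumr big_seq_cond [leRHS]big_seq_cond; apply: ler_sum => r /andP[/iP /andP[r0 rx] _].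
  rewrite /lnnat -ln_div ?posrE ?ltr0n //; apply/ltW/ln_sublinear.
  by rewrite divr_gt0 // ltr0n.
(* The first factor [p] of [r = s p] is charged to [s] and summed by Chebyshev; powers [p ^ k] with
   [k >= 2] are counted trivially. With [E1] the constants are [1 + 2 + 2], where [1 <= H] absorbs
   the last 2. *)
have E2 : \sum_(r <- iota 1 x | G r) lnn r <= 2 * x%:R * H + 2 * x%:R.
  have -> : \sum_(r <- iota 1 x | G r) lnn r =
     psum (fun p => \sum_(r <- iota 1 x | G r) (logn p r)%:R * lnn p) x.
    rewrite /psum exchange_big /= big_seq_cond [RHS]big_seq_cond.
    apply: eq_bigr => r /andP[/iP /andP[r0 rx] _]; apply: lnn_factor => // p pp pr.
    exact: leq_trans (dvdn_leq r0 pr) rx.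
  apply: le_trans (_ : psum (fun p => lnn p * \sum_(s <- iota 1 x | G s && (s * p <= x)%N) 1 +
                       x%:R * (lnn p / (p%:R * (p%:R - 1)))) x <= _).
    apply: le_psum => p pp px; rewrite -mulr_suml mulrC.
    have p1 : 1 < p%:R :> R by rewrite ltr1n prime_gt1.
    have -> : x%:R * (lnn p / (p%:R * (p%:R - 1))) = lnn p * (x%:R / (p%:R * (p%:R - 1))).
      by rewrite mulrCA.
    rewrite -mulrDr ler_wpM2l ?lnn_ge0 //.
    have cnt k : (0 < k)%N -> \sum_(r <- iota 1 x | G r) ((p ^ k %| r)%N : nat)%:R <= x%:R * (p%:R^-1) ^+ k :> R.
      move=> k0; rewrite exprVn -natrX.
      apply: le_trans (natr_div_le R _ _).
      apply: le_trans (_ : \sum_(r <- iota 1 x | G r && (p ^ k %| r)%N) 1 <= _).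
        rewrite big_mkcondr; apply: ler_sum => r _; by case: ifP.
      rewrite -big_filter; pose d := (p ^ k)%N.
      have d0 : (0 < d)%N by rewrite expn_gt0 prime_gt0.
      apply: le_trans (_ : \sum_(r <- [seq (s * d)%N | s <- iota 1 (x %/ d)]) 1 <= _).
        apply: sum_cover => //; first by rewrite filter_uniq ?iota_uniq.
        move=> r; rewrite mem_filter => /andP[/andP[_ dr] /iP /andP[r0 rx]].
        apply/mapP; exists (r %/ d)%N; last by rewrite divnK.
        by rewrite mem_iota add1n ltnS divn_gt0 // dvdn_leq //= leq_div2r.
      by rewrite big_map big_const_seq count_predT size_iota iter_addr_0.
    apply: le_trans (_ : \sum_(r <- iota 1 x | G r) (((p %| r)%N : nat)%:R +
        \sum_(2 <= k < x.+2) ((p ^ k %| r)%N : nat)%:R) <= _).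
      rewrite big_seq_cond [leRHS]big_seq_cond; apply: ler_sum => r /andP[/iP /andP[r0 rx] _].
      rewrite -natr_sum -natrD ler_nat logn_count_dvd //.
      rewrite -{2}[p]expn1 -(@big_ltn _ _ _ 1 x.+2) //.
      rewrite [leqRHS](@big_cat_nat _ _ _ r) //=; last lia.
      by rewrite leq_addr.
    rewrite big_split /= exchange_big /=; apply: lerD.
      apply: le_trans (_ : \sum_(r <- iota 1 x | G r && (p %| r)%N) 1 <= _).
        rewrite big_mkcondr; apply: ler_sum => r _; by case: ifP.
      apply: le_trans (_ : \sum_(r <- [seq (s * p)%N | s <- iota 1 x & G s && (s * p <= x)%N]) 1 <= _);
        last by rewrite big_map big_filter.
      rewrite -[leLHS]big_filter; apply: sum_cover => //; first by rewrite filter_uniq ?iota_uniq.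
      move=> r; rewrite mem_filter => /andP[/andP[Gr pr] /iP /andP[r0 rx]].
      apply/mapP; exists (r %/ p)%N; last by rewrite divnK.
      rewrite mem_filter divnK // rx andbT (herG r) ?dvdn_div //=.
      rewrite mem_iota add1n ltnS divn_gt0 ?prime_gt0 // dvdn_leq //=.
      exact: leq_trans (leq_div _ _) rx.
    apply: le_trans (_ : \sum_(2 <= k < x.+2) x%:R * p%:R^-1 ^+ k <= _).
      rewrite big_nat [leRHS]big_nat; apply: ler_sum => k /andP[k2 _]; apply: cnt; lia.
    rewrite -mulr_sumr ler_wpM2l //.
    have := @geo_sum_le R (p%:R^-1) x.+1; rewrite big_ltn // expr1 => /(_ _ _).
    have -> : p%:R^-1 / (1 - p%:R^-1) = p%:R^-1 + (p%:R * (p%:R - 1))^-1 :> R.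
      by field; neq0_lra.
    rewrite lerD2l; apply; first by rewrite invr_ge0.
    by rewrite invf_lt1 //; lra.
  rewrite psumD psumZ; apply: lerD; last first.
    by rewrite mulrC ler_wpM2r // psum_ln_sq_le.
  rewrite /psum; under eq_bigr do rewrite mulr_sumr.
  rewrite (eq_bigr (fun p => \sum_(s <- iota 1 x | G s) if (s * p <= x)%N then lnn p else 0)); last first.
    by move=> p _; rewrite big_mkcondr; apply: eq_bigr => s _; case: ifP; rewrite ?mulr1.
  rewrite exchange_big /= [leRHS]mulr_sumr big_seq_cond [leRHS]big_seq_cond.
  apply: ler_sum => s /andP[/iP /andP[s0 sx] _].
  apply: le_trans (_ : psum lnn (x %/ s) <= _).
    rewrite /psum -big_mkcondr /=.
    rewrite -big_filter -[leRHS]big_filter; apply: sum_cover.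
    - by rewrite filter_uniq ?iota_uniq.
    - move=> p; rewrite !mem_filter !mem_index_iota /= => /andP[/andP[-> spx] _] /=.
      by rewrite ltnS leq_divRL // mulnC.
    by move=> t _; exact: lnn_ge0.
  apply: le_trans (chebyshev_theta_le R _) _; rewrite -mulrA ler_wpM2l //; exact: natr_div_le.
have -> : (\sum_(r <- iota 1 x | G r) 1) * lnn x =
  \sum_(r <- iota 1 x | G r) (lnn x - lnn r) + \sum_(r <- iota 1 x | G r) lnn r.
  by rewrite sumrB subrK mulr_suml; apply: eq_bigr => r _; rewrite mul1r.
have : 2 * x%:R <= 2 * x%:R * H by rewrite ler_peMr // mulr_ge0.
move: E1 E2; rewrite -!mulrA; set y := x%:R * H; lra.
Qed.

(** * Integers without small prime factors *)

Definition expand p K (L : seq nat) := [seq (m * p ^ k)%N | m <- L, k <- iota 0 K.+1].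

Lemma sum_expand p K L (F : nat -> R) :
  \sum_(m <- expand p K L) F m = \sum_(m <- L) \sum_(k <- iota 0 K.+1) F (m * p ^ k)%N.
Proof. by rewrite /expand big_allpairs_dep. Qed.

Lemma geo0_le p K : prime p -> \sum_(k <- iota 0 K.+1) p%:R^-1 ^+ k <= (1 - p%:R^-1)^-1 :> R.
Proof.
move=> pp; have p1 : 1 < p%:R :> R by rewrite ltr1n prime_gt1.
have -> : iota 0 K.+1 = index_iota 0 K.+1 by rewrite /index_iota subn0.
rewrite big_ltn // expr0.
have -> : (1 - p%:R^-1)^-1 = 1 + p%:R^-1 / (1 - p%:R^-1) :> R by field; neq0_lra.
rewrite lerD2l; apply: geo_sum_le; first by rewrite invr_ge0.
by rewrite invf_lt1 //; lra.
Qed.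

(* The products of powers [q ^ k], [k <= K], of the primes [q] in [(y, y + j]]. *)
Fixpoint rough_list y j K :=
  if j is j'.+1 then
    let L := rough_list y j' K in
    if prime (y + j'.+1) then expand (y + j'.+1) K L else L
  else [:: 1%N].

Lemma rough_list_sum y j K :
  \sum_(m <- rough_list y j K) m%:R^-1 <= vprod y / vprod (y + j).
Proof.
elim: j => [|j IH] /=.
  by rewrite big_seq1 invr1 addn0 mulfV // gt_eqF // vprod_gt0.
rewrite addnS vprodS; case: ifP => pz; last by rewrite mulr1.
rewrite sum_expand invfM mulrA.
under eq_bigr => m _ do under eq_bigr => k _ do rewrite natrM natrX invfM -exprVn.
under eq_bigr => m _ do rewrite -mulr_sumr.
rewrite -mulr_suml; apply: ler_pM => //.
- by apply: sumr_ge0 => m _; rewrite invr_ge0.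
- by apply: sumr_ge0 => m _; rewrite exprn_ge0 // invr_ge0.
exact: geo0_le.
Qed.

Lemma rough_listP y j K n : (0 < n)%N -> (n <= 2 ^ K)%N -> (n`_(sm y) = 1)%N ->
  (n`_(sm (y + j)))%N \in rough_list y j K.
Proof.
move=> n0 nK ry; elim: j => [|j IH] /=; first by rewrite addn0 ry mem_seq1.
rewrite addnS smS //; case: ifP => pz; last by rewrite muln1.
apply/allpairsP; exists ((n`_(sm (y + j)))%N, logn (y + j).+1 n); split=> //.
rewrite mem_iota /=; rewrite add0n ltnS -(@leq_exp2l 2) //.
apply: leq_trans nK; apply: leq_trans (dvdn_leq n0 (pfactor_dvdnn (y + j).+1 n)).
by case: (logn _ _) => [|k] //; rewrite leq_exp2r // prime_gt1.
Qed.

(** The sum of [1 / s] over the rough [s <= x] is at most [vprod y / vprod x], hence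
    [O(vprod y * ln x)], and this logarithm cancels the one gained in [hereditary_count_le]. *)
Lemma rough_count_le : exists2 C : R, 0 < C & forall x y, (1 < x)%N -> (y <= x)%N ->
  \sum_(r <- iota 1 x | (r`_(sm y) == 1)%N) 1 <= C * x%:R * vprod y.
Proof.
have [C C0 hC] := vprod_inv_le; exists (5 * C); first by rewrite mulr_gt0.
move=> x y x1 yx; have x0 : (0 < x)%N := ltnW x1.
have lx := lnn_gt0 R x1.
rewrite -(ler_pM2r lx).
apply: le_trans (_ : 5 * x%:R * \sum_(s <- iota 1 x | (s`_(sm y) == 1)%N) s%:R^-1 <= _).
  apply: (@hereditary_count_le (fun r => (r`_(sm y) == 1)%N)) => //.
    by rewrite partn1.
  move=> r s r0 /eqP rr sr; rewrite -dvdn1 -rr; exact: partn_dvd.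
have h : \sum_(s <- iota 1 x | (s`_(sm y) == 1)%N) s%:R^-1 <= vprod y * (C * lnn x) :> R.
  apply: le_trans (_ : vprod y / vprod x <= _); last first.
    by rewrite ler_wpM2l ?(ltW (vprod_gt0 _)) // hC.
  rewrite -{2}(subnKC yx); apply: le_trans (rough_list_sum y (x - y) x).
  rewrite -big_filter; apply: sum_cover.
  - by rewrite filter_uniq ?iota_uniq.
  - move=> s; rewrite mem_filter mem_iota add1n ltnS => /andP[/eqP ry /andP[s0 sx]].
    have := @rough_listP y (x - y) x s s0 _ ry; rewrite subnKC // sm_big //; apply.
    by apply: leq_trans sx _; apply: ltnW; apply: ltn_expl.
  by move=> t _; rewrite invr_ge0.
apply: le_trans (ler_wpM2l _ h) _; first by rewrite mulr_ge0.
by rewrite le_eqVlt; apply/orP; left; apply/eqP; ring.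
Qed.

End Sieve.

(** * The upper bound *)

Lemma nat_root_ex k n : 0 < k -> exists w, w ^ k <= n < w.+1 ^ k.
Proof.
move=> k0; elim: n => [|n [w /andP[h1 h2]]]; first by exists 0; rewrite exp0n // exp1n.
have [h|h] := leqP (w.+1 ^ k) n.+1; last by exists w; rewrite h (leq_trans h1).
exists w.+1; rewrite h /=; apply: leq_ltn_trans h2 _.
by rewrite ltn_exp2r.
Qed.

Lemma pnat_gt0 (pi : nat_pred) n : pi.-nat n -> 0 < n.
Proof. by case/andP. Qed.

(* If [n] is practical, its smallest prime factor beyond those of a prefix [m] is at most
   [Sf ustar m + 2 <= theta m]. *)
Definition theta m := 3 * Sf ustar m.

Section Process.
Variables (Y K : nat).

Definition alive z (L : seq nat) := [seq m <- L | z <= theta m].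

Definition advance z L := if prime z then expand z K (alive z L) else alive z L.

(* The possible [z]-smooth parts [m <= Y] of chains alive at [z]. Exponents are cut at [K],
   which is harmless for [n <= 2 ^ K]. *)
Fixpoint states z := if z is z'.+1 then [seq m <- advance z (states z') | m <= Y] else [:: 1].

Definition crossed z := [seq m <- advance z (states z.-1) | Y < m].

(** The bound [Sf ustar m <= m ^ 2] makes the time [z <= theta m] polynomially bounded in [m]. *)
Definition state_inv z m := [&& (sm z).-nat m, z <= theta m, m <= Sf ustar m & Sf ustar m <= m ^ 2].

Lemma sm_natS z m : (sm z).-nat m -> (sm z.+1).-nat m.
Proof. by apply: sub_in_pnat => q _; rewrite !inE => /leqW. Qed.

Lemma sm_nat_ndvd z p m : (sm z).-nat m -> prime p -> z < p -> ~~ (p %| m).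
Proof.
move=> zm pp zp; apply/negP => pm; have m0 := pnat_gt0 zm.
by have /pnatP /(_ p pp pm) := zm; rewrite m0 inE leqNgt zp => /(_ isT).
Qed.

Lemma St_le_sqr p k : prime p -> St p k <= (p ^ k) ^ 2.
Proof.
move=> pp; case: k => [|k]; first by rewrite St0 expn0.
apply: leq_trans (St_le _ pp) _; rewrite -expnM leq_exp2l ?prime_gt1 //; lia.
Qed.

Lemma inv_advance z L : all (state_inv z) L -> all (state_inv z.+1) (advance z.+1 L).
Proof.
move=> /allP HL; apply/allP => M; rewrite /advance.
case: ifP => pz; last first.
  rewrite mem_filter => /andP[zM /HL /and4P[h1 _ h3 h4]].
  by rewrite /state_inv sm_natS // zM h3 h4.
case/allpairsP => -[m k] [/=]; rewrite mem_filter => /andP[zm mL] _ ->.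
have /and4P[h1 _ h3 h4] := HL m mL; have m0 := pnat_gt0 h1.
have pm := sm_nat_ndvd h1 pz (leqnn _).
have X0 : 0 < z.+1 ^ k by rewrite expn_gt0.
have S1 : 0 < St z.+1 k := leq_trans X0 (St_ge k pz).
apply/and4P; split.
- rewrite pnatM sm_natS //= pnatX; apply/orP; left.
  by apply/pnatP => // q qp /dvdn_leq; rewrite inE; apply.
- apply: leq_trans zm _; rewrite /theta Sf_mulX // leq_mul2l leq_pmulr //.
- by rewrite Sf_mulX // leq_mul // St_ge.
- by rewrite Sf_mulX // expnMn leq_mul // St_le_sqr.
Qed.

Lemma inv_states z : all (state_inv z) (states z).
Proof.
elim: z => [|z IH] /=; first by rewrite /state_inv /theta Sf1 /= /pnat.
by apply/allP => m; rewrite mem_filter => /andP[_]; apply/allP/inv_advance.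
Qed.

Lemma inv_crossed z : 0 < z -> all (state_inv z) (crossed z).
Proof.
case: z => // z _; apply/allP => m; rewrite mem_filter => /andP[_].
by apply/allP/inv_advance/inv_states.
Qed.

Lemma alive_inv z m : m \in alive z.+1 (states z) ->
  [/\ state_inv z m, z.+1 <= theta m, 0 < m & m \in states z].
Proof.
rewrite mem_filter => /andP[zm mL]; have h := allP (inv_states z) m mL.
by split=> //; have /and4P[/pnat_gt0] := h.
Qed.

Variable R : realType.
Local Open Scope ring_scope.
Local Notation lnn := (lnnat R).
Local Notation vprod := (vprod R).

(** * Mass and mean potential of the chains *)

Definition imass (L : seq nat) : R := \sum_(m <- L) m%:R^-1.
Local Notation mass := imass.

(** Up to the cut of exponents, the probability that a chain passes the test at [z.+1] without
    having crossed [Y], before the exponent of [z.+1] is drawn. *)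
Definition alpha z := vprod z * mass (alive z.+1 (states z)).
Definition energy z (L : seq nat) := vprod z * \sum_(m <- L) m%:R^-1 * (lnn (theta m) - lnn z).

Lemma mass_ge0 L : 0 <= mass L.
Proof. by apply: sumr_ge0 => m _; rewrite invr_ge0. Qed.

Lemma alpha_ge0 z : 0 <= alpha z.
Proof. by rewrite mulr_ge0 ?mass_ge0 // ltW // vprod_gt0. Qed.

Lemma mass_filter (a : pred nat) L : mass (filter a L) + mass (filter (predC a) L) = mass L.
Proof. by rewrite /imass [RHS](bigID a) !big_filter. Qed.

Lemma mass_filter_le (a : pred nat) L : mass (filter a L) <= mass L.
Proof. by rewrite -[leRHS](mass_filter a) lerDl mass_ge0. Qed.

(** The cut at [K] loses probability, hence an inequality; it goes in the right direction because it
    multiplies nonnegative masses and potentials. *)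
Lemma geo0_normalized p : prime p -> (1 - p%:R^-1) * \sum_(k <- iota 0 K.+1) p%:R^-1 ^+ k <= 1 :> R.
Proof.
move=> pp; have h := euler_factor_gt0 R pp.
rewrite -ler_pdivlMl // mulr1; exact: geo0_le.
Qed.

Lemma mass_advance z L : vprod z.+1 * mass (advance z.+1 L) <= vprod z * mass (alive z.+1 L).
Proof.
rewrite vprodS /advance; case: ifP => pz; last by rewrite mulr1.
rewrite -mulrA ler_wpM2l ?(ltW (vprod_gt0 R z)) // /imass sum_expand mulr_sumr.
apply: ler_sum => m _.
under eq_bigr => k _ do rewrite natrM natrX invfM -exprVn.
rewrite -mulr_sumr mulrCA ler_piMr ?invr_ge0 //; exact: geo0_normalized.
Qed.

Lemma alpha_le_mass z : alpha z <= vprod z * mass (states z).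
Proof. by rewrite ler_wpM2l ?(ltW (vprod_gt0 R z)) // mass_filter_le. Qed.

Lemma mass_step z :
  vprod z.+1 * mass (states z.+1) + vprod z.+1 * mass (crossed z.+1) <= alpha z.
Proof.
apply: le_trans (mass_advance z (states z)); rewrite -mulrDr.
rewrite -(mass_filter (fun m => m <= Y)%N (advance z.+1 (states z))).
rewrite /crossed /= (eq_filter (_ : predC (fun m => m <= Y)%N =1 (fun m => Y < m)%N)) //.
by move=> m /=; rewrite ltnNge.
Qed.

Lemma mass_crossed_ge0 z : 0 <= vprod z * mass (crossed z).
Proof. by rewrite mulr_ge0 ?mass_ge0 // ltW // vprod_gt0. Qed.

Lemma alpha_mono z : alpha z.+1 <= alpha z.
Proof.
apply: le_trans (mass_step z); apply: le_trans (alpha_le_mass _) _.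
by rewrite lerDl mass_crossed_ge0.
Qed.

Lemma alpha_le w z : (w <= z)%N -> alpha z <= alpha w.
Proof.
move=> /subnKC <-; elim: (z - w)%N => [|j IH]; first by rewrite addn0.
by rewrite addnS; apply: le_trans (alpha_mono _) IH.
Qed.

Lemma alpha0_le1 : alpha 0 <= 1.
Proof.
by apply: le_trans (alpha_le_mass _) _; rewrite vprod0 /imass big_seq1 invr1 mul1r.
Qed.

(* Bounds the mean increment of [ln theta] caused by the prime [p]. *)
Definition drift p : R := if prime p then lnn p * (p%:R^-1 + 4 * p%:R^-1 ^+ 2) else 0.

Lemma drift_sum_le n : \sum_(2 <= k < n.+1) (drift k - (lnn k - lnn k.-1)) <= 10.
Proof.
case: (ltnP n 2) => n2; first by rewrite big_geq.
rewrite sumrB -psum_nat.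
have -> : \sum_(2 <= i < n.+1) (lnn i - lnn i.-1) = lnn n.
  case: n n2 => [|[|n]] // _; elim: n => [|n IH]; first by rewrite big_nat1 lnn1 subr0.
  by rewrite big_nat_recr //= IH; lra.
have h : psum (fun p => lnn p * (p%:R^-1 + 4 * p%:R^-1 ^+ 2)) n <=
   mert R n + 4 * psum (fun p => lnn p / (p%:R * (p%:R - 1))) n.
  rewrite /mert -psumZ -psumD; apply: le_psum => p pp _.
  rewrite mulrDr lerD2l mulrCA ler_wpM2l // ler_wpM2l ?lnn_ge0 //.
  have p1 : 1 < p%:R :> R by rewrite ltr1n prime_gt1.
  by rewrite expr2 -invfM lef_pV2 ?posrE; nra.
have := psum_ln_sq_le R n; have := mert_le R n; move: h; lra.
Qed.

(** With [x = 1 / p], exponent 1 contributes [(1 - x) x ln p]. Exponent [k >= 2] contributes at most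
    [(1 - x) (k + 1) x ^ k ln p], as [St p k <= p ^ (k + 1)]; these sum to at most [4 x ^ 2 ln p]
    for [x <= 1 / 2]. *)
Lemma drift_ge p : prime p ->
  (1 - p%:R^-1) * \sum_(k <- iota 0 K.+1) p%:R^-1 ^+ k * lnn (St p k) <= drift p.
Proof.
move=> pp; rewrite /drift pp; have x0 := primeV_gt0 R pp; have x2 := primeV_le R pp.
move: (p%:R^-1) x0 x2 => x x0 x2.
have l0 : 0 <= lnn p := lnn_ge0 R p.
case: K => [|k].
  rewrite big_seq1 St0 lnn1 !mulr0 mulr_ge0 // addr_ge0 ?(ltW x0) //.
  by rewrite mulr_ge0 // exprn_ge0 // ltW.
(* The subtracted term bounds the tail not yet summed, which lets the induction close. *)
suff H : (1 - x) * \sum_(i <- iota 0 k.+2) x ^+ i * lnn (St p i) <=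
    lnn p * (x * (1 - x) + 4 * x ^+ 2 - (k%:R + 4) * x ^+ k.+2).
  apply: le_trans H _; rewrite ler_wpM2l //.
  have : 0 <= (k%:R + 4) * x ^+ k.+2 by rewrite mulr_ge0 ?addr_ge0 // exprn_ge0 // ltW.
  have : 0 <= x ^+ 2 by rewrite exprn_ge0 // ltW.
  rewrite !expr2; lra.
elim: k => [|k IH].
  by rewrite /= !big_cons big_nil St0 lnn1 St1 // expr1 !expr2; lra.
rewrite -[X in iota 0 X]addn1 iotaD big_cat /= big_seq1 add0n mulrDr.
have h : lnn (St p k.+2) <= (k%:R + 3) * lnn p.
  apply: le_trans (lnn_le R (St_le k.+2 pp)) _.
  by rewrite lnnX ?prime_gt0 // -natrD ler_wpM2r // ler_nat; lia.
have X0 : 0 <= x ^+ k.+2 by rewrite exprn_ge0 // ltW.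
have h2 : (1 - x) * (x ^+ k.+2 * lnn (St p k.+2)) <= (1 - x) * (x ^+ k.+2 * ((k%:R + 3) * lnn p)).
  by apply: ler_wpM2l; [lra|apply: ler_wpM2l].
apply: le_trans (lerD IH h2) _; rewrite (exprS x k.+2).
set X := x ^+ k.+2 in X0 *; set l := lnn p in l0 *.
rewrite -subr_ge0.
have -> : l * (x * (1 - x) + 4 * x ^+ 2 - (k.+1%:R + 4) * (x * X)) -
   (l * (x * (1 - x) + 4 * x ^+ 2 - (k%:R + 4) * X) + (1 - x) * (X * ((k%:R + 3) * l))) =
   l * X * (1 - 2 * x) by ring.
apply: mulr_ge0; first exact: mulr_ge0.
by lra.
Qed.

Lemma energy_filter (a : pred nat) z L : energy z (filter a L) + energy z (filter (predC a) L) = energy z L.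
Proof. by rewrite /energy -mulrDr [in RHS](bigID a) !big_filter. Qed.

Lemma pot_ge0 z m : (0 < z)%N -> state_inv z m -> 0 <= lnn (theta m) - lnn z.
Proof. by move=> z0 /and4P[_ h _ _]; rewrite subr_ge0 lnn_le. Qed.

Lemma energy_ge0 z L : (0 < z)%N -> all (state_inv z) L -> 0 <= energy z L.
Proof.
move=> z0 /allP h; rewrite mulr_ge0 ?(ltW (vprod_gt0 R z)) // big_seq.
by apply: sumr_ge0 => m /h hm; rewrite mulr_ge0 ?invr_ge0 // pot_ge0.
Qed.

Lemma energy_advance z : (0 < z)%N -> energy z.+1 (advance z.+1 (states z)) <=
  energy z (alive z.+1 (states z)) + alpha z * (drift z.+1 - (lnn z.+1 - lnn z)).
Proof.
move=> z0.
have -> : energy z (alive z.+1 (states z)) + alpha z * (drift z.+1 - (lnn z.+1 - lnn z)) =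
   vprod z * \sum_(m <- alive z.+1 (states z)) m%:R^-1 * (lnn (theta m) - lnn z.+1 + drift z.+1).
  rewrite /energy /alpha /imass -mulrA -mulrDr mulr_suml -big_split /=; congr (_ * _).
  by apply: eq_bigr => m _; ring.
rewrite /energy vprodS /advance; case: ifP => pz; last first.
  rewrite mulr1 ler_wpM2l ?(ltW (vprod_gt0 R z)) //; apply: ler_sum => m _.
  by rewrite /drift pz addr0.
rewrite -mulrA ler_wpM2l ?(ltW (vprod_gt0 R z)) // sum_expand mulr_sumr.
rewrite big_seq [leRHS]big_seq; apply: ler_sum => m /alive_inv[im zm m0 _].
have /and4P[h1 _ h3 _] := im; have pm := sm_nat_ndvd h1 pz (leqnn _).
set A := lnn (theta m) - lnn z.+1.
have A0 : 0 <= A by rewrite subr_ge0 lnn_le.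
have -> : \sum_(k <- iota 0 K.+1) (m * z.+1 ^ k)%:R^-1 * (lnn (theta (m * z.+1 ^ k)) - lnn z.+1) =
   m%:R^-1 * (A * \sum_(k <- iota 0 K.+1) z.+1%:R^-1 ^+ k +
     \sum_(k <- iota 0 K.+1) z.+1%:R^-1 ^+ k * lnn (St z.+1 k)).
  rewrite [A * _]mulr_sumr -big_split /= mulr_sumr; apply: eq_bigr => k _.
  rewrite natrM natrX invfM -exprVn /theta Sf_mulX // mulnA lnnM.
  - by rewrite /A /theta; set u := _^-1; set w := _ ^+ k; ring.
  - by rewrite muln_gt0 /=; apply: leq_trans h3.
  - by apply: leq_trans (St_ge k pz); rewrite expn_gt0.
rewrite mulrCA ler_wpM2l ?invr_ge0 // mulrDr mulrCA; apply: lerD.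
  by rewrite ler_piMr //; exact: geo0_normalized.
exact: drift_ge.
Qed.

(* The dropped chains have nonnegative potential, so only the drift minus the step of [ln z]
   remains; its partial sums are bounded by Mertens and its weights [alpha] decrease. *)
Lemma energy_step z : (0 < z)%N -> energy z.+1 (states z.+1) + energy z.+1 (crossed z.+1) <=
  energy z (states z) + alpha z * (drift z.+1 - (lnn z.+1 - lnn z)).
Proof.
move=> z0.
have -> : energy z.+1 (states z.+1) + energy z.+1 (crossed z.+1) = energy z.+1 (advance z.+1 (states z)).
  rewrite -(energy_filter (fun m => m <= Y)%N _ (advance z.+1 (states z))).
  rewrite /crossed /= (eq_filter (_ : predC (fun m => m <= Y)%N =1 (fun m => Y < m)%N)) //.
  by move=> m /=; rewrite ltnNge.
apply: le_trans (energy_advance z0) _; rewrite lerD2r.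
rewrite -[leRHS](energy_filter (fun m => z.+1 <= theta m)%N) lerDl energy_ge0 //.
by apply/allP => m; rewrite mem_filter => /andP[_]; apply/allP/inv_states.
Qed.

(** [13] is 3, bounding [ln (theta 1)] at time 1, plus 10 for the excess of the drift over [ln],
    weighted by the nonincreasing [alpha <= 1]. *)
Lemma energy_total n : (0 < n)%N ->
  energy n (states n) + \sum_(2 <= z < n.+1) energy z (crossed z) <= 13.
Proof.
move=> n0; apply: le_trans (_ : 3 + \sum_(2 <= z < n.+1) alpha z.-1 * (drift z - (lnn z - lnn z.-1)) <= _).
  case: n n0 => // n _; elim: n => [|n IH].
    rewrite !big_geq // !addr0 /energy vprod1 mul1r /=.
    have h : advance 1 [:: 1%N] = [:: 1%N] by rewrite /advance /= /alive /= /theta Sf1.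
    rewrite h /=; case: ifP => _; last by rewrite big_nil.
    rewrite big_seq1 invr1 mul1r lnn1 subr0 /theta Sf1; exact: lnn_le_nat.
  rewrite !(@big_nat_recr _ _ _ n.+2) //=.
  have := energy_step (ltn0Sn n); move: IH; rewrite /=; lra.
have := @abel_le R (fun z => alpha z.-1) (fun z => drift z - (lnn z - lnn z.-1)) 2 n 10.
move=> /(_ _ _ _ _) H.
apply: le_trans (lerD (lexx 3) (H _ _ _ _)) _ => //.
- by move=> k _; exact: alpha_ge0.
- by case=> [|k] // _; exact: alpha_mono.
- by move=> k _; exact: drift_sum_le.
have : alpha 1 <= 1 by apply: le_trans (alpha_mono 0) alpha0_le1.
rewrite /=; lra.
Qed.

Lemma energy_states_le n : (0 < n)%N -> energy n (states n) <= 13.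
Proof.
move=> n0; apply: le_trans (energy_total n0); rewrite lerDl big_nat.
apply: sumr_ge0 => z /andP[z2 _]; apply: energy_ge0; first lia.
by apply: inv_crossed; lia.
Qed.

Lemma energy_crossed_le n : (0 < n)%N -> \sum_(2 <= z < n.+1) energy z (crossed z) <= 13.
Proof.
by move=> n0; apply: le_trans (energy_total n0); rewrite lerDr energy_ge0 // inv_states.
Qed.

(* A chain alive at [t] either has [theta >= t] already at [w], which Markov's inequality
   bounds through the energy, or picks up a prime between [w] and [t]. *)
Definition beta t j := vprod j * mass [seq m <- states j | t <= theta m]%N.

(** A chain with [theta < t] can reach [t] at the prime [j.+1] only through a positive exponent,
    whose probability is at most [1 / j.+1]. *)
Lemma beta_step t j : beta t j.+1 <= beta t j + (if prime j.+1 then alpha j * j.+1%:R^-1 else 0).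
Proof.
apply: le_trans (_ : vprod j.+1 * mass [seq m <- advance j.+1 (states j) | t <= theta m]%N <= _).
  rewrite ler_wpM2l ?(ltW (vprod_gt0 R _)) // /= -filter_predI.
  rewrite (eq_filter (_ : _ =1 predI (fun m => m <= Y)%N (fun m => t <= theta m)%N)); last first.
    by move=> m /=; rewrite andbC.
  rewrite filter_predI; exact: mass_filter_le.
rewrite vprodS /advance; case: ifP => pz.
  rewrite -mulrA /beta /alpha -mulrA -mulrDr ler_wpM2l ?(ltW (vprod_gt0 R _)) //.
  rewrite /imass big_filter big_mkcond sum_expand [leRHS]addrC.
  rewrite mulr_suml mulr_sumr.
  apply: le_trans (_ : \sum_(m <- alive j.+1 (states j)) (m%:R^-1 / j.+1%:R +
     (if (t <= theta m)%N then m%:R^-1 else 0)) <= _); last first.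
    rewrite big_split /= lerD2l /alive !big_filter [leLHS]big_mkcond [leRHS]big_mkcond.
    by apply: ler_sum => m _; case: (t <= _)%N; case: (j < _)%N; rewrite ?invr_ge0.
  apply: ler_sum => m _.
  have p1 := euler_factor_gt0 R pz; have p2 := euler_factor_le1 R pz.
  rewrite -[iota 0 K.+1]/(0%N :: iota 1 K) big_cons expn0 muln1 mulrDr addrC; apply: lerD.
    apply: le_trans (_ : (1 - j.+1%:R^-1) * \sum_(1 <= k < K.+1) m%:R^-1 * j.+1%:R^-1 ^+ k <= _).
      rewrite ler_wpM2l ?(ltW p1) // /index_iota subn1 /=; apply: ler_sum => k _.
      rewrite natrM natrX invfM -exprVn; case: ifP => // _.
      by rewrite mulr_ge0 ?exprn_ge0 ?invr_ge0.
    rewrite -mulr_sumr mulrCA ler_wpM2l ?invr_ge0 //.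
    rewrite -ler_pdivlMl // mulrC; apply: geo_sum_le; first by rewrite invr_ge0.
    by move: p1; rewrite subr_gt0.
  by case: ifP => _; rewrite ?mulr0 // ler_piMl // invr_ge0.
rewrite mulr1 addr0 ler_wpM2l ?(ltW (vprod_gt0 R _)) // -filter_predI.
rewrite (eq_filter (_ : _ =1 predI (fun m => j.+1 <= theta m)%N (fun m => t <= theta m)%N)); last first.
  by move=> m /=; rewrite andbC.
rewrite filter_predI; exact: mass_filter_le.
Qed.

Lemma beta_le t w n : (w <= n)%N ->
  beta t n <= beta t w + alpha w * (psum (fun p => p%:R^-1) n - psum (fun p => p%:R^-1) w).
Proof.
move=> /subnKC <-; elim: (n - w)%N => [|j IH]; first by rewrite addn0 subrr mulr0 addr0.
rewrite addnS psumS; apply: le_trans (beta_step _ _) _.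
have : (if prime (w + j).+1 then alpha (w + j) * (w + j).+1%:R^-1 else 0) <=
   alpha w * (if prime (w + j).+1 then (w + j).+1%:R^-1 else 0).
  case: ifP => _; last by rewrite mulr0.
  by rewrite ler_wpM2r ?invr_ge0 // alpha_le // leq_addr.
move: IH; rewrite !mulrBr mulrDr.
move: (alpha w * (if _ then _ else _)) => b; move: (if _ then _ else _) => a.
move: (alpha w * _) (alpha w * _) => c d; lra.
Qed.

Lemma psum_inv_diff_le w n : (1 < w)%N -> (w <= n)%N ->
  (psum (fun p => p%:R^-1) n - psum (fun p => p%:R^-1) w) * lnn w <= lnn n - lnn w + 5.
Proof.
move=> w1 wn; apply: le_trans (mert_diff_le R n (ltnW w1)).
move: wn => /subnKC <-; elim: (n - w)%N => [|j IH]; first by rewrite addn0 !subrr mul0r.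
rewrite addnS psumS [mert R _.+1]psumS -/(mert R _).
have : (if prime (w + j).+1 then (w + j).+1%:R^-1 else 0) * lnn w <=
  (if prime (w + j).+1 then lnn (w + j).+1 / (w + j).+1%:R else 0).
  case: ifP => _; last by rewrite mul0r.
  by rewrite mulrC ler_wpM2r ?invr_ge0 // lnn_le // leqW // leq_addr.
move: IH; rewrite !mulrBl mulrDl.
move: ((if _ then _ else _) * _) => a; move: (if _ then _ else _) => b.
move: (psum _ _ * _) (psum _ _ * _) => c d; lra.
Qed.

Lemma beta_markov t w : (0 < w)%N -> (w < t)%N -> beta t w * (lnn t - lnn w) <= 13.
Proof.
move=> w0 wt; apply: le_trans (energy_states_le w0).
rewrite -[leRHS](energy_filter (fun m => t <= theta m)%N).
apply: le_trans (_ : energy w [seq m <- states w | (t <= theta m)%N] <= _).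
  rewrite /beta -mulrA ler_wpM2l ?(ltW (vprod_gt0 R _)) // /imass mulr_suml.
  rewrite big_seq [leRHS]big_seq; apply: ler_sum => m; rewrite mem_filter => /andP[tm _].
  by rewrite ler_wpM2l ?invr_ge0 // lerD2r lnn_le.
rewrite lerDl energy_ge0 //; apply/allP => m; rewrite mem_filter => /andP[_].
by apply/allP/inv_states.
Qed.

(* With [w] close to [n ^ (2/3)] the recursion for [beta] contracts. *)
Lemma alpha_bound n : (0 < n)%N -> alpha n * lnn n <= 400.
Proof.
elim/ltn_ind: n => n IH n0.
have a1 : alpha n <= 1 by apply: le_trans (alpha_le (leq0n n)) alpha0_le1.
have a0 := alpha_ge0 n.
(* Small [n] follow from [alpha n <= 1]; beyond [200] the additive constants are negligible. *)
case: (lerP (lnn n) 200) => [l200|l200].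
  apply: le_trans (ler_wpM2r (lnn_ge0 R n) a1) _; lra.
have [w /andP[w1 w2]] := @nat_root_ex 3 (n ^ 2) isT.
have w0 : (0 < w)%N.
  case: w w1 w2 => // _; rewrite exp1n ltnS leqn0 expn_eq0 /= andbT => /eqP n00.
  by rewrite n00 in n0.
have h1 : 3 * lnn w <= 2 * lnn n.
  by have := lnn_le R w1; rewrite !lnnX.
have h2 : 2 * lnn n <= 3 * (lnn w + 1).
  apply: le_trans (_ : 3 * lnn w.+1 <= _).
    by have := lnn_le R (ltnW w2); rewrite !lnnX.
  have := lnnS_le R w0; have : w%:R^-1 <= 1 :> R by rewrite invf_le1 ?ltr0n // ler1n.
  set u := w%:R^-1; lra.
have wn : (w < n)%N.
  rewrite ltnNge; apply/negP => /(lnn_le R); lra.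
have w11 : (1 < w)%N.
  by case: w h2 {w1 w2 h1 wn} w0 => [|[|w]] //; rewrite lnn1; lra.
have hb := @beta_markov n.+1 w w0 (leqW wn).
have hp := psum_inv_diff_le w11 (ltnW wn).
have hbl := @beta_le n.+1 w n (ltnW wn).
(* By definition [beta n.+1 n] is [alpha n]. *)
rewrite -/(alpha n) -[beta n.+1 n]/(alpha n) in hbl.
have IHw := IH w wn w0; have aw0 := alpha_ge0 w.
have ln1 : lnn n <= lnn n.+1 by apply: lnn_le.
have b0 : 0 <= beta n.+1 w by rewrite mulr_ge0 ?mass_ge0 // ltW // vprod_gt0.
move: (beta _ _) (alpha n) (alpha w) (lnn n) (lnn w) (lnn n.+1) (psum _ _ - psum _ _)
  hb hp hbl IHw aw0 ln1 b0 h1 h2 l200 a0 a1 {IH w1 w2} => b an aw ln lw ln' D.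
move=> hb hp hbl IHw aw0 ln1 b0 h1 h2 l200 a0 a1.
have lw0 : 0 < lw by lra.
have B1 : b * (ln / 3) <= 13.
  by apply: le_trans hb; apply: ler_wpM2l => //; lra.
have B2 : aw * D * (lw * lw) <= 400 * (ln - lw + 5).
  have -> : aw * D * (lw * lw) = (aw * lw) * (D * lw) by ring.
  apply: le_trans (_ : aw * lw * (ln - lw + 5) <= _).
    by apply: ler_wpM2l => //; rewrite mulr_ge0 // ltW.
  by apply: ler_wpM2r => //; lra.
(* For [lw] near [2 / 3 * ln] the ratio is [(1 / 3) / (2 / 3) ^ 2 = 3 / 4]; [9 / 10] leaves room for
   lower order terms. *)
have B3 : (ln - lw + 5) * ln <= 9 / 10 * (lw * lw).
  apply: le_trans (_ : (ln / 3 + 6) * ln <= _); first by apply: ler_wpM2r; lra.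
  apply: le_trans (_ : 9 / 10 * ((2 / 3 * ln - 1) * (2 / 3 * ln - 1)) <= _).
    have : 200 * ln <= ln * ln by apply: ler_wpM2r; lra.
    lra.
  apply: ler_wpM2l; first lra.
  by apply: ler_pM; lra.
have B4 : aw * D * ln <= 360.
  have : aw * D * ln * (lw * lw) <= 360 * (lw * lw).
    have : aw * D * (lw * lw) * ln <= 400 * (ln - lw + 5) * ln by apply: ler_wpM2r => //; lra.
    lra.
  by rewrite ler_pM2r // mulr_gt0.
(* Markov contributes [3 * 13 = 39] and the recursion [400 * 9 / 10 = 360]. *)
have : an * ln <= (b + aw * D) * ln by apply: ler_wpM2r => //; lra.
lra.
Qed.

(** Chains crossing after time [w] passed the test at [w.+1], so the crossings at different times
    take disjoint shares of [alpha w]. *)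
Lemma mass_crossed_late w n : (w <= n)%N ->
  \sum_(w.+1 <= z < n.+1) vprod z * mass (crossed z) <= alpha w.
Proof.
move=> wn; case: (ltnP w n) => [{}wn|nw]; last by rewrite big_geq // alpha_ge0.
suff H : vprod n * mass (states n) + \sum_(w.+1 <= z < n.+1) vprod z * mass (crossed z) <= alpha w.
  by apply: le_trans H; rewrite lerDr mulr_ge0 ?mass_ge0 // ltW // vprod_gt0.
move: wn => /subnKC <-; elim: (n - w.+1)%N => [|j IH].
  by rewrite addn0 big_nat1; exact: mass_step.
rewrite addnS big_nat_recr /=; last lia.
have := mass_step (w.+1 + j); have := alpha_le_mass (w.+1 + j).
move: IH; rewrite /=; lra.
Qed.

(** A crossing at [z <= w] has potential at least [ln Y - ln w], so Markov applies to the energy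
    that leaves through crossings. *)
Lemma mass_crossed_early w : (1 < w)%N -> (w < Y)%N ->
  (\sum_(2 <= z < w.+1) vprod z * mass (crossed z)) * (lnn Y - lnn w) <= 13.
Proof.
move=> w1 wY; apply: le_trans (energy_crossed_le (ltnW w1)).
rewrite mulr_suml big_nat [leRHS]big_nat; apply: ler_sum => z /andP[z2 zw].
rewrite -mulrA ler_wpM2l ?(ltW (vprod_gt0 R _)) // /imass mulr_suml.
rewrite big_seq [leRHS]big_seq; apply: ler_sum => m mc.
have z0 : (0 < z)%N by lia.
have /and4P[_ _ h3 _] := allP (inv_crossed z0) m mc.
move: mc; rewrite mem_filter => /andP[Ym _].
rewrite ler_wpM2l ?invr_ge0 // lerB // lnn_le //.
by apply: leq_trans (ltnW Ym) (leq_trans h3 _); rewrite /theta leq_pmull.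
Qed.

(** Crossings up to [w], about [sqrt Y], are bounded by energy, later ones by survival. As
    [ln w >= ln Y / 4], the constants are [26 + 1600]. *)
Lemma mass_crossed_le n : (0 < n)%N -> 4 <= lnn Y ->
  (\sum_(2 <= z < n.+1) vprod z * mass (crossed z)) * lnn Y <= 1700.
Proof.
move=> n0 lY; have [w /andP[w1 w2]] := @nat_root_ex 2 Y isT.
have Y0 : (0 < Y)%N by case: (posnP Y) lY => // ->; rewrite /lnnat ln0 //; lra.
have w0 : (0 < w)%N by case: w w1 w2 => // _; rewrite exp1n; lia.
have h1 : 2 * lnn w <= lnn Y by have := lnn_le R w1; rewrite lnnX.
have h2 : lnn Y <= 2 * (lnn w + 1).
  apply: le_trans (_ : 2 * lnn w.+1 <= _).
    by have := lnn_le R (ltnW w2); rewrite lnnX.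
  have := lnnS_le R w0; have : w%:R^-1 <= 1 :> R by rewrite invf_le1 ?ltr0n // ler1n.
  set u := w%:R^-1; lra.
have w11 : (1 < w)%N.
  by case: w h2 {w1 w2 h1} w0 => [|[|w]] //; rewrite lnn1; lra.
have wY : (w < Y)%N by rewrite ltnNge; apply/negP => /(lnn_le R); lra.
have E := mass_crossed_early w11 wY.
have A := alpha_bound w0; have a0 := alpha_ge0 w.
set S := \sum_(2 <= z < n.+1) _.
have S0 : S <= \sum_(2 <= z < w.+1) vprod z * mass (crossed z) + alpha w.
  case: (leqP n w) => nw.
    apply: le_trans (_ : \sum_(2 <= z < w.+1) vprod z * mass (crossed z) <= _); last by rewrite lerDl.
    apply: sum_cover; rewrite ?iota_uniq //; last by move=> z _; exact: mass_crossed_ge0.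
    by move=> z; rewrite !mem_index_iota; lia.
  rewrite /S (@big_cat_nat _ _ _ w.+1) //=; try lia.
  by rewrite lerD2l mass_crossed_late // ltnW.
have e0 : 0 <= \sum_(2 <= z < w.+1) vprod z * mass (crossed z).
  by apply: sumr_ge0 => z _; exact: mass_crossed_ge0.
move: (\sum_(2 <= z < w.+1) _) (alpha w) S S0 E A a0 e0 => e a S S0 E A a0 e0.
have : S * lnn Y <= (e + a) * lnn Y by apply: ler_wpM2r => //; lra.
move: (lnn Y) (lnn w) lY h1 h2 E A => y x lY h1 h2 E A.
have : e * (y / 2) <= 13 by apply: le_trans E; apply: ler_wpM2l => //; lra.
have : a * (y / 4) <= 400 by apply: le_trans A; apply: ler_wpM2l => //; lra.
lra.
Qed.

End Process.

(** * From practical integers to crossing chains *)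

Lemma logn_le_bound p n K : prime p -> 0 < n -> n <= 2 ^ K -> logn p n <= K.
Proof.
move=> pp n0 nK; rewrite -(@leq_exp2l 2) //; apply: leq_trans nK.
apply: leq_trans (dvdn_leq n0 (pfactor_dvdnn p n)).
by case: (logn _ _) => [|k] //; rewrite leq_exp2r // prime_gt1.
Qed.

Lemma mem_advance K z n (L : seq nat) : 0 < n -> n <= 2 ^ K -> n`_(sm z) \in L ->
  z.+1 <= theta n`_(sm z) -> n`_(sm z.+1) \in advance K z.+1 L.
Proof.
move=> n0 nK nL zt; have nA : n`_(sm z) \in alive z.+1 L by rewrite mem_filter zt.
rewrite smS // /advance; case: ifP => pz; last by rewrite muln1.
apply/allpairsP; exists (n`_(sm z), logn z.+1 n); split=> //.
by rewrite mem_iota /= add0n ltnS logn_le_bound.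
Qed.

(** The least prime [q > z] of [n] would satisfy [q <= Sf ustar m + 2 <= theta m <= z] for the
    prefix [m]. *)
Lemma practical_stuck n z : 0 < n -> f_practical ustar n -> theta n`_(sm z) < z.+1 ->
  n`_(sm z) = n.
Proof.
move=> n0 pn tz; apply: part_pnat_id; apply/pnatP => // p pp pd; rewrite inE.
case: (leqP p z) => // zp; exfalso.
have [q [qp qd zq qmin]] : exists q, [/\ prime q, q %| n, z < q & forall r, prime r -> r %| n -> z < r -> q <= r].
  have ex : exists q, [&& prime q, q %| n & z < q] by exists p; rewrite pp pd zp.
  exists (ex_minn ex); case: ex_minnP => q /and3P[h1 h2 h3] h4; split=> // r r1 r2 r3.
  by apply: h4; rewrite r1 r2 r3.
have := practical_prime_le n0 pn qp qd.
have -> : n`_(sm q.-1) = n`_(sm z).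
  apply: eq_in_partn => r rp; rewrite !inE; apply/idP/idP => h; last lia.
  have [rpr rn] : prime r /\ r %| n by move: rp; rewrite mem_primes => /and3P[].
  by rewrite leqNgt; apply/negP => zr; have := qmin r rpr rn zr; have := prime_gt0 qp; lia.
have : 0 < Sf ustar n`_(sm z).
  rewrite /Sf (big_rem 1) /= ?ustar1 //; by rewrite -dvdn_divisors ?part_gt0 // dvd1n.
move: tz zq; rewrite /theta; lia.
Qed.

(** If the chain of [n] were dropped, [n] would equal its prefix, a state and so at most [Y]. *)
Lemma practical_crosses Y K n : 0 < n -> n <= 2 ^ K -> f_practical ustar n -> Y < n ->
  exists2 p, 0 < p <= n & n`_(sm p) \in crossed Y K p.
Proof.
move=> n0 nK pn Yn.
have H z : z <= n -> n`_(sm z) \in states Y K z \/ exists2 p, 0 < p <= n & n`_(sm p) \in crossed Y K p.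
  elim: z => [|z IH] zn; first by left; rewrite sm0 mem_seq1.
  case: (IH (ltnW zn)) => [nz|]; last by right.
  case: (leqP z.+1 (theta n`_(sm z))) => [zt|tz].
    have nN := mem_advance n0 nK nz zt.
    case: (leqP n`_(sm z.+1) Y) => h; first by left; rewrite /= mem_filter h.
    by right; exists z.+1 => //; rewrite mem_filter h.
  exfalso; have e := practical_stuck n0 pn tz; rewrite e in nz.
  case: z zn tz e nz {IH} => [|z] zn tz e; last by rewrite /= mem_filter leqNgt Yn.
  by rewrite /theta sm0 Sf1 in tz.
case: (H n (leqnn _)) => //; rewrite sm_big //.
by case: n n0 Yn {nK pn H} => // n _ Yn; rewrite /= mem_filter leqNgt Yn.
Qed.

(** These rare [n] are set aside: a high power of the crossing prime may make their prefix too large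
    for the sieve. *)
Definition big_square Y n := has (fun d => (Y ^ 2 < d) && (d ^ 2 %| n)) (iota 1 n).

(** Before the crossing [m <= Y], so [p <= theta m <= 3 Y ^ 2 <= Y ^ 4]; without big squares
    [p ^ k <= Y ^ 6]. Thus [M <= Y ^ 7] and [M * p <= Y ^ 11]. The conclusions are what the sieve of
    length [N %/ M] requires. *)
Lemma crossed_small Y K N n p : 1 < Y -> Y ^ 12 <= N -> 0 < p -> 0 < n -> ~~ big_square Y n ->
  n`_(sm p) \in crossed Y K p ->
  (n`_(sm p) * p <= N) && (2 * n`_(sm p) <= N).
Proof.
move=> Y1 YN p0 n0 nsq; rewrite mem_filter => /andP[YM MN].
case: p p0 MN YM => // z _; rewrite /advance /=.
case: ifP => [pz|_]; last first.
  rewrite mem_filter => /andP[_]; case: z => [|z]; last first.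
    by rewrite /= mem_filter => /andP[h _]; rewrite ltnNge h.
  by rewrite mem_seq1 => /eqP ->; lia.
case/allpairsP => -[m k] [/= mA _ E] YM.
have [/and4P[h1 _ _ h4] zm m0 mP] := alive_inv mA.
have mY : m <= Y.
  case: z mP {zm mA h1 pz E YM} => [|z]; first by rewrite mem_seq1 => /eqP ->; exact: ltnW.
  by rewrite /= mem_filter => /andP[].
have pzm : z.+1 <= 3 * Y ^ 2.
  apply: leq_trans zm _; rewrite /theta leq_mul2l /=; apply: leq_trans h4 _.
  by rewrite leq_exp2r.
have Y4 : 3 <= Y ^ 2 by rewrite (@leq_trans (2 ^ 2)) // leq_exp2r.
have pY4 : z.+1 <= Y ^ 4 by apply: leq_trans pzm _; rewrite (_ : 4 = 2 + 2) // expnD leq_mul2r Y4 orbT.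
have kpos : 0 < k.
  by case: k E YM => // ->; rewrite muln1 ltnNge mY.
have XY6 : z.+1 ^ k <= Y ^ 6.
  case: k kpos E => [|[|k]] // _ E.
    by rewrite expn1; apply: leq_trans pY4 _; rewrite leq_exp2l.
  rewrite leqNgt; apply/negP => big; move/negP: nsq; apply.
  have dv : z.+1 ^ k.+2 %| n.
    by apply: dvdn_trans (dvdn_part (sm z.+1) n); rewrite E dvdn_mull.
  (* An exponent [e >= 2] satisfies [e <= 3 * e./2], so [d ^ 3] exceeds [Y ^ 6] and [d] exceeds
     [Y ^ 2]. *)
  set d := z.+1 ^ (k.+2)./2.
  have d2 : d ^ 2 %| n.
    by apply: dvdn_trans dv; rewrite -expnM dvdn_exp2l //; lia.
  have d0 : 0 < d by rewrite expn_gt0.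
  apply/hasP; exists d.
    rewrite mem_iota d0 add1n ltnS; apply: dvdn_leq => //.
    by apply: dvdn_trans d2; rewrite expnS dvdn_mulr.
  rewrite d2 andbT -(@ltn_exp2r _ _ 3) // -expnM; apply: leq_trans big _.
  by rewrite -expnM leq_pexp2l //; lia.
have MY : n`_(sm z.+1) <= Y ^ 7.
  by rewrite E (_ : 7 = 1 + 6) // expnD expn1 leq_mul.
apply/andP; split; apply: leq_trans YN.
  by apply: leq_trans (leq_mul MY pY4) _; rewrite -expnD leq_exp2l.
apply: leq_trans (_ : Y * Y ^ 7 <= _); first by rewrite leq_mul.
by rewrite -expnS leq_exp2l.
Qed.

Section Count.
Variable R : realType.
Local Open Scope ring_scope.
Local Notation lnn := (lnnat R).
Local Notation vprod := (vprod R).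

Lemma count_sum (a : pred nat) s : (count a s)%:R = \sum_(n <- s | a n) 1 :> R.
Proof. by rewrite big_const_seq iter_addr_0. Qed.

Lemma sum_inv_sq_le a N : (0 < a)%N -> \sum_(d <- iota 1 N | (a < d)%N) (d ^ 2)%:R^-1 <= a%:R^-1 :> R.
Proof.
move=> a0; have a0' : 0 < a%:R :> R by rewrite ltr0n.
rewrite -big_filter.
apply: le_trans (_ : \sum_(a.+1 <= d < (a + N).+1) (d ^ 2)%:R^-1 <= _).
  apply: sum_cover; first by rewrite filter_uniq ?iota_uniq.
    by move=> d; rewrite mem_filter mem_iota mem_index_iota; lia.
  by move=> d _; rewrite invr_ge0.
apply: le_trans (_ : a%:R^-1 - (a + N)%:R^-1 <= _); last by rewrite gerBl invr_ge0.
elim: N => [|N IH]; first by rewrite addn0 big_geq // subrr.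
rewrite addnS big_nat_recr /=; last lia.
apply: le_trans (lerD IH (lexx _)) _.
have b0 : 0 < (a + N)%:R :> R by rewrite ltr0n; lia.
rewrite natrX -[(a + N).+1%:R]natr1.
move: (a + N)%:R b0 => b b0.
have : b^-1 - (b + 1)^-1 - (b + 1) ^- 2 = (b * (b + 1) ^+ 2)^-1 by field; neq0_lra.
have : 0 < (b * (b + 1) ^+ 2)^-1 by rewrite invr_gt0 mulr_gt0 // exprn_gt0 //; lra.
move: (_^-1) (_^-1) (_^-1) (_^-1) => *; lra.
Qed.

Lemma big_square_count_le Y N : (0 < Y)%N ->
  \sum_(n <- iota 1 N | big_square Y n) 1 <= N%:R / Y%:R :> R.
Proof.
move=> Y0.
apply: le_trans (_ : \sum_(n <- iota 1 N) \sum_(d <- iota 1 N | (Y ^ 2 < d)%N) (if (d ^ 2 %| n)%N then 1 else 0) <= _).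
  rewrite big_mkcond big_seq [leRHS]big_seq; apply: ler_sum => n; rewrite mem_iota => nN.
  have pos : 0 <= \sum_(d <- iota 1 N | (Y ^ 2 < d)%N) (if (d ^ 2 %| n)%N then 1 else 0) :> R.
    by apply: sumr_ge0 => d _; case: ifP.
  case: ifP => // /hasP[d]; rewrite mem_iota => dn /andP[Yd d2].
  rewrite (big_rem d) /=; last by rewrite mem_iota; lia.
  by rewrite Yd d2 lerDl; apply: sumr_ge0 => e _; case: ifP.
rewrite exchange_big /=.
apply: le_trans (_ : \sum_(d <- iota 1 N | (Y ^ 2 < d)%N) N%:R * (d ^ 2)%:R^-1 <= _).
  apply: ler_sum => d Yd; have d0 : (0 < d ^ 2)%N by rewrite expn_gt0 (leq_ltn_trans _ Yd).
  apply: le_trans (natr_div_le R _ _).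
  rewrite -big_mkcond -big_filter.
  apply: le_trans (_ : \sum_(r <- [seq (s * d ^ 2)%N | s <- iota 1 (N %/ d ^ 2)]) 1 <= _); last first.
    by rewrite big_map big_const_seq count_predT size_iota iter_addr_0.
  apply: sum_cover => //; first by rewrite filter_uniq ?iota_uniq.
  move=> r; rewrite mem_filter mem_iota add1n ltnS => /andP[dr /andP[r0 rN]].
  apply/mapP; exists (r %/ d ^ 2)%N; last by rewrite divnK.
  by rewrite mem_iota add1n ltnS divn_gt0 // dvdn_leq //= leq_div2r.
rewrite -mulr_sumr ler_wpM2l //.
have Y20 : (0 < Y ^ 2)%N by rewrite expn_gt0 Y0.
apply: le_trans (sum_inv_sq_le _ Y20) _.
by rewrite lef_pV2 ?posrE ?ltr0n // ler_nat -{1}[Y]expn1 leq_pexp2l.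
Qed.

Lemma practical_count_le : exists2 C : R, 0 < C & forall N Y, (1 < Y)%N -> 4 <= lnn Y ->
  (Y ^ 12 <= N)%N -> (F_count ustar N)%:R * lnn Y <= C * N%:R.
Proof.
have [C C0 hC] := rough_count_le R; exists (2 + C * 1700); first by rewrite addr_gt0 // mulr_gt0.
move=> N Y Y1 lY YN; have Y0 : (0 < Y)%N by lia.
have N0 : (0 < N)%N by apply: leq_trans YN; rewrite expn_gt0 Y0.
have NN : 0 <= N%:R :> R by [].
have ly : 0 < lnn Y by lra.
set K := N; have NK : (N <= 2 ^ K)%N by apply: ltnW; apply: ltn_expl.
pose S := \sum_(2 <= z < N.+1) vprod z * imass R (crossed Y K z).
have hS : S * lnn Y <= 1700 by apply: mass_crossed_le.
pose good p M := ((M * p <= N) && (2 * M <= N))%N.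
have split : (F_count ustar N)%:R <= Y%:R + N%:R / Y%:R +
   \sum_(n <- iota 1 N | [&& f_practical ustar n, (Y < n)%N & ~~ big_square Y n]) 1 :> R.
  rewrite /F_count count_sum.
  apply: le_trans (_ : \sum_(n <- iota 1 N | (n <= Y)%N) 1 + \sum_(n <- iota 1 N | big_square Y n) 1 +
     \sum_(n <- iota 1 N | [&& f_practical ustar n, (Y < n)%N & ~~ big_square Y n]) 1 <= _).
    rewrite big_mkcond [X in X + _ + _]big_mkcond [X in _ + X + _]big_mkcond [X in _ + _ + X]big_mkcond /=.
    rewrite -!big_split /=; apply: ler_sum => n _.
    case: (f_practical _ _); case: (leqP n Y) => _; case: (big_square _ _) => /=; lra.
  rewrite lerD2r; apply: lerD; last exact: big_square_count_le.
  rewrite -big_filter.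
  apply: le_trans (_ : \sum_(n <- iota 1 Y) 1 <= _).
    apply: sum_cover => //; first by rewrite filter_uniq ?iota_uniq.
    by move=> n; rewrite mem_filter !mem_iota; lia.
  by rewrite big_const_seq count_predT size_iota iter_addr_0.
have main : \sum_(n <- iota 1 N | [&& f_practical ustar n, (Y < n)%N & ~~ big_square Y n]) 1 <= C * N%:R * S.
  rewrite -big_filter.
  pose L := flatten [seq flatten [seq [seq (M * r)%N | r <- iota 1 (N %/ M) & (r`_(sm p) == 1)%N]
                      | M <- crossed Y K p & good p M] | p <- iota 1 N].
  apply: le_trans (_ : \sum_(n <- L) 1 <= _).
    apply: sum_cover => //; first by rewrite filter_uniq ?iota_uniq.
    move=> n; rewrite mem_filter mem_iota add1n ltnS => /andP[/and3P[pn Yn nsq] /andP[n0 nN]].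
    have [p /andP[p0 pn'] pc] := practical_crosses n0 (leq_trans nN NK) pn Yn.
    apply/flattenP; eexists; first by apply/mapP; exists p; [rewrite mem_iota p0 add1n ltnS (leq_trans pn' nN)|reflexivity].
    apply/flattenP; eexists.
      by apply/mapP; exists (n`_(sm p))%N; [rewrite mem_filter pc andbT; exact: (crossed_small (N := N)) pc|reflexivity].
    have e := partnC (sm p) n0.
    apply/mapP; exists (n`_(sm p)^')%N; last by rewrite e.
    have M0 : (0 < n`_(sm p))%N by rewrite part_gt0.
    rewrite mem_filter mem_iota part_gt0 add1n ltnS leq_divRL // mulnC e nN andbT.
    by rewrite part_p'nat // part_pnat.
  rewrite /L big_flatten /= big_map /= /S mulr_sumr.
  have -> : iota 1 N = index_iota 1 N.+1 by rewrite /index_iota subn1.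
  (* Nothing crosses at time 1, so the sum starts at 2 as in [S]. *)
  rewrite big_ltn // (_ : crossed Y K 1 = [::]); last first.
    rewrite /crossed /advance /= /alive /= /theta Sf1 /=.
    by case: ltnP => //; lia.
  rewrite /= big_nil add0r big_nat [leRHS]big_nat; apply: ler_sum => p /andP[p2 pN].
  rewrite big_flatten /= big_map big_filter big_mkcond /= /imass mulrA mulr_sumr.
  rewrite big_seq [leRHS]big_seq; apply: ler_sum => M Mc.
  case: ifP => [/andP[Mp M2]|_]; last first.
    by rewrite !mulr_ge0 ?invr_ge0 ?(ltW C0) // ltW // vprod_gt0.
  rewrite big_map big_filter.
  have p0 : (0 < p)%N := ltnW p2.
  have M0 : (0 < M)%N by have /and4P[/pnat_gt0] := allP (inv_crossed Y K p0) M Mc.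
  apply: le_trans (hC _ p _ _) _; first by rewrite leq_divRL.
    by rewrite leq_divRL // mulnC.
  have -> : C * N%:R * vprod p / M%:R = C * (N%:R / M%:R) * vprod p by ring.
  rewrite ler_wpM2r ?(ltW (vprod_gt0 R _)) // ler_wpM2l ?(ltW C0) //; exact: natr_div_le.
have Ypos : 0 < Y%:R :> R by rewrite ltr0n.
have t1 : Y%:R * lnn Y <= N%:R.
  apply: le_trans (ler_wpM2l (ltW Ypos) (lnn_le_nat R Y)) _.
  rewrite -natrM ler_nat; apply: leq_trans YN; rewrite -[X in (X <= _)%N]/(Y ^ 2)%N.
  by rewrite leq_exp2l.
have t2 : N%:R / Y%:R * lnn Y <= N%:R.
  rewrite mulrAC ler_pdivrMr // ler_wpM2l //; exact: lnn_le_nat.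
have t3 : C * N%:R * S * lnn Y <= C * N%:R * 1700.
  by rewrite -[leLHS]mulrA ler_wpM2l // mulr_ge0 // ltW.
have := ler_wpM2r (ltW ly) (le_trans split (lerD (lexx _) main)).
rewrite !mulrDl; move: t1 t2 t3.
move: (_ * lnn Y) (_ * lnn Y) (_ * lnn Y) (_ * lnn Y) => x1 x2 x3 x4; lra.
Qed.

End Count.

(** * The lower bound *)

(* For squarefree [m], [Sf ustar m = m]. *)
Definition good m := [&& 0 < m, f_practical ustar m & Sf ustar m == m].

Lemma good1 : good 1.
Proof.
rewrite /good Sf1 eqxx andbT /=; apply/f_practicalP => //; rewrite Sf1 => t t1.
case: t t1 => [|[|]] // _; first by exists [::]; rewrite big_nil.
by exists [:: 1]; split=> //; rewrite big_seq1 ustar1.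
Qed.

Lemma good_mul m p : good m -> prime p -> ~~ (p %| m) -> p <= m + 2 -> good (m * p).
Proof.
case/and3P => m0 pm /eqP S pp pd pl; apply/and3P; split.
- by rewrite muln_gt0 m0 prime_gt0.
- by apply: practical_mul => //; rewrite S.
- by rewrite Sf_mulp // S.
Qed.

Definition primorial z := \prod_(0 <= p < z.+1 | prime p) p.

Lemma primorialS z : primorial z.+1 = primorial z * (if prime z.+1 then z.+1 else 1).
Proof. by rewrite /primorial big_mkcond big_nat_recr //= -big_mkcond. Qed.

Lemma primorial_gt0 z : 0 < primorial z.
Proof. by apply: prodn_cond_gt0 => p; exact: prime_gt0. Qed.

Lemma dvdn_primorial z p : prime p -> p <= z -> p %| primorial z.
Proof.
move=> pp; elim: z => [|z IH]; first by rewrite leqn0 => /eqP p0; rewrite p0 in pp.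
rewrite leq_eqVlt primorialS => /orP[/eqP pz|/IH pz]; last by rewrite dvdn_mulr.
by rewrite -pz pp dvdn_mull.
Qed.

Lemma sm_nat_primorial z : (sm z).-nat (primorial z).
Proof.
elim: z => [|z IH]; first by rewrite /primorial big_mkcond big_nat1 /pnat.
rewrite primorialS pnatM sm_natS //=; case: ifP => // pz.
by rewrite pnatE // inE.
Qed.

(* Euclid's argument bounds each prime by the product of the smaller ones plus 1. *)
Lemma good_primorial z : good (primorial z).
Proof.
elim: z => [|z IH]; first by rewrite /primorial big_mkcond big_nat1 good1.
rewrite primorialS; case: ifP => pz; last by rewrite muln1.
apply: good_mul => //; first exact: sm_nat_ndvd (sm_nat_primorial z) pz (leqnn _).
set P := primorial z; have P0 : 0 < P := primorial_gt0 z.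
have qp : prime (pdiv P.+1) by rewrite pdiv_prime.
have zq : z < pdiv P.+1.
  rewrite ltnNge; apply/negP => /(dvdn_primorial qp); rewrite -/P => dP.
  have : pdiv P.+1 %| P + 1 by rewrite addn1 pdiv_dvd.
  rewrite dvdn_addr // dvdn1 => /eqP e.
  by rewrite e in qp.
have := pdiv_leq (ltn0Sn P); lia.
Qed.

(** * The squarefree chains *)

Section LowerProcess.
Variables (z0 m0 Y : nat).
Hypotheses (z0_gt0 : 0 < z0) (m0_good : good m0) (m0_sm : (sm z0).-nat m0).
Hypotheses (z0_m0 : z0 <= m0) (m0_Y : m0 < Y).

Definition lalive z (L : seq nat) := [seq m <- L | z <= m].

Definition ladvance z L :=
  if prime z then lalive z L ++ [seq m * z | m <- lalive z L] else lalive z L.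

(* [lstates j] is the state at time [z0 + j]; [lcrossed j] leaves at time [z0 + j.+1]. *)
Fixpoint lstates j :=
  if j is j'.+1 then [seq m <- ladvance (z0 + j) (lstates j') | m < Y] else [:: m0].

Definition lcrossed j := [seq m <- ladvance (z0 + j.+1) (lstates j) | Y <= m].

Definition lstate_inv z m := [&& good m, (sm z).-nat m & z <= m].

Lemma linv_lstates j : all (fun m => lstate_inv (z0 + j) m && (m < Y)) (lstates j).
Proof.
elim: j => [|j /allP IH]; first by rewrite /= addn0 /lstate_inv m0_good m0_sm z0_m0 m0_Y.
apply/allP => M /=; rewrite mem_filter => /andP[-> ]; rewrite andbT addnS /ladvance.
case: ifP => pz; last first.
  rewrite mem_filter => /andP[zM /IH /andP[/and3P[h1 h2 _] _]].
  by rewrite /lstate_inv h1 sm_natS.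
rewrite mem_cat => /orP[|/mapP[m]]; rewrite mem_filter => /andP[zM /IH /andP[/and3P[h1 h2 _] _]].
  by rewrite /lstate_inv h1 sm_natS.
move=> ->; apply/and3P; split.
- apply: good_mul => //; first exact: sm_nat_ndvd h2 pz (leqnn _).
  by apply: leq_trans zM _; rewrite leq_addr.
- by rewrite pnatM sm_natS //= pnatE // inE.
- by apply: leq_trans zM _; rewrite leq_pmulr.
Qed.

Lemma lcrossedP j M : M \in lcrossed j -> prime (z0 + j.+1) /\
  exists m, [/\ M = m * (z0 + j.+1), good M, (sm (z0 + j)).-nat m, m < Y & (z0 + j.+1 <= m) && (Y <= M)].
Proof.
rewrite mem_filter => /andP[YM]; rewrite /ladvance.
have notA : M \notin lalive (z0 + j.+1) (lstates j).
  rewrite mem_filter; apply/negP => /andP[_ /(allP (linv_lstates j)) /andP[_]].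
  by rewrite ltnNge YM.
case: ifP => pz; last by rewrite (negbTE notA).
rewrite mem_cat (negbTE notA) /= => /mapP[m mA eM]; split=> //; exists m.
move: mA; rewrite mem_filter => /andP[zm /(allP (linv_lstates j)) /andP[/and3P[h1 h2 h3] h4]].
split=> //; rewrite ?zm ?YM // eM; apply: good_mul => //.
  by apply: sm_nat_ndvd h2 pz _; rewrite addnS.
by apply: leq_trans zm _; rewrite leq_addr.
Qed.

Lemma uniq_ladvance j : uniq (lstates j) -> uniq (ladvance (z0 + j.+1) (lstates j)).
Proof.
move=> u; rewrite /ladvance; case: ifP => pz; last by rewrite filter_uniq.
have p0 := prime_gt0 pz.
rewrite cat_uniq filter_uniq // map_inj_uniq ?filter_uniq ?andbT //; last first.
  by move=> x y /eqP; rewrite eqn_pmul2r // => /eqP.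
apply/hasPn => M /mapP[m _ ->]; apply/negP; rewrite mem_filter.
move=> /andP[_ /(allP (linv_lstates j)) /andP[/and3P[_ h2 _] _]].
have zz : z0 + j < z0 + j.+1 by rewrite addnS.
by have /negP := sm_nat_ndvd h2 pz zz; apply; exact: dvdn_mull.
Qed.

Lemma uniq_lstates j : uniq (lstates j).
Proof. by elim: j => [|j IH] //=; rewrite filter_uniq // uniq_ladvance. Qed.

Lemma uniq_lcrossed j : uniq (lcrossed j).
Proof. by rewrite filter_uniq // uniq_ladvance // uniq_lstates. Qed.

Variable R : realType.
Local Open Scope ring_scope.
Local Notation lnn := (lnnat R).
Local Notation vprod := (vprod R).
Local Notation mass := (imass R).

(** Normalises the squarefree process, where the exponent of [p] is 0 or 1 with weights proportional
    to 1 and [1 / p]. *)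
Fixpoint wprod j : R :=
  if j is j'.+1 then wprod j' * (if prime (z0 + j) then (1 + (z0 + j)%:R^-1)^-1 else 1) else 1.

Lemma wprod_gt0 j : 0 < wprod j.
Proof.
elim: j => [|j IH] //=; apply: mulr_gt0 => //; case: ifP => // _.
by rewrite invr_gt0 addr_gt0 // invr_gt0 ltr0n addnS.
Qed.

(** The quotient of [1 / (1 + 1 / p)] by [1 - 1 / p] is [1 / (1 - 1 / p ^ 2)]. Over all integers
    these factors telescope, whence the factor [(z + 1) / z] in the induction. *)
Lemma wprod_le_vprod j : wprod j * vprod z0 <= 2 * vprod (z0 + j).
Proof.
have z0p : 1 <= z0%:R :> R by rewrite ler1n.
suff H : wprod j * vprod z0 * ((z0 + j)%:R + 1) / (z0 + j)%:R <= 2 * vprod (z0 + j).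
  apply: le_trans H; rewrite -mulrA ler_peMr //.
    by rewrite mulr_ge0 ?(ltW (wprod_gt0 _)) ?(ltW (vprod_gt0 _ _)).
  by rewrite ler_pdivlMr ?mul1r ?lerDl // ltr0n addn_gt0 z0_gt0.
elim: j => [|j IH].
  rewrite addn0 mul1r mulrAC -[leLHS]mulrA mulrC ler_wpM2r ?(ltW (vprod_gt0 _ _)) //.
  by rewrite mulrC ler_pdivrMr; lra.
rewrite addnS vprodS /= addnS -natr1.
have zp : 1 <= (z0 + j)%:R :> R by rewrite ler1n addn_gt0 z0_gt0.
have w0 := wprod_gt0 j; have v0 := vprod_gt0 R z0; have v1 := vprod_gt0 R (z0 + j).
move: IH w0 v0 v1; move: (wprod j) (vprod z0) (vprod (z0 + j)) => w v0 v IH w_0 v0_0 v_0.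
case: ifP => pz.
  move: ((z0 + j)%:R) zp IH => x x1 IH.
  have -> : w * (1 + (x + 1)^-1)^-1 * v0 * (x + 1 + 1) / (x + 1) = w * v0 by field; neq0_lra.
  have -> : 2 * (v * (1 - (x + 1)^-1)) = 2 * v * x / (x + 1) by field; neq0_lra.
  rewrite ler_pdivlMr; last lra.
  by move: IH; rewrite ler_pdivrMr //; lra.
rewrite !mulr1; apply: le_trans IH.
rewrite -!mulrA ler_wpM2l ?(ltW w_0) // ler_wpM2l ?(ltW v0_0) //.
move: ((z0 + j)%:R) zp => x x1.
rewrite ler_pdivrMr; last lra.
have -> : (x + 1) / x * (x + 1) = x + 2 + x^-1 by field; neq0_lra.
by have : 0 < x^-1 by [rewrite invr_gt0; lra]; lra.
Qed.

Definition lalpha j := wprod j * mass (lalive (z0 + j.+1) (lstates j)).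
Definition lenergy j (L : seq nat) := wprod j * \sum_(m <- L) m%:R^-1 * (lnn m - lnn (z0 + j)).
(** Under the weights of [wprod], [1 / (p + 1)] is the probability that [p] is adjoined. *)
Definition ldrift p : R := if prime p then lnn p / (p%:R + 1) else 0.

Lemma mass_ladvance j : wprod j.+1 * mass (ladvance (z0 + j.+1) (lstates j)) = lalpha j.
Proof.
rewrite /ladvance /=; case: ifP => pz; last by rewrite mulr1.
have p0 : 0 < (z0 + j.+1)%:R :> R by rewrite ltr0n prime_gt0.
rewrite /lalpha /imass big_cat big_map /= -mulrA; congr (_ * _).
have -> : \sum_(m <- lalive (z0 + j.+1) (lstates j)) (m * (z0 + j.+1))%:R^-1 =
   (\sum_(m <- lalive (z0 + j.+1) (lstates j)) m%:R^-1) / (z0 + j.+1)%:R :> R.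
  by rewrite mulr_suml; apply: eq_bigr => m _; rewrite natrM invfM.
move: (\sum_(_ <- _) _) ((z0 + j.+1)%:R) p0 => S x x0.
by field; neq0_lra.
Qed.

Lemma lalpha_ge0 j : 0 <= lalpha j.
Proof. by rewrite mulr_ge0 ?mass_ge0 // ltW // wprod_gt0. Qed.

Lemma lalpha_mono j : lalpha j.+1 <= lalpha j.
Proof.
rewrite -(mass_ladvance j) ler_wpM2l ?(ltW (wprod_gt0 _)) //=.
exact: le_trans (mass_filter_le _ _ _) (mass_filter_le _ _ _).
Qed.

Lemma lalpha0_le : lalpha 0 <= m0%:R^-1.
Proof.
rewrite /lalpha mul1r; apply: le_trans (mass_filter_le _ _ _) _.
by rewrite /imass big_seq1.
Qed.

(* An identity: a state dropped at [z0 + j.+1] equals [z0 + j] and has potential 0. *)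
Lemma lenergy_ladvance j : lenergy j.+1 (ladvance (z0 + j.+1) (lstates j)) =
  lenergy j (lstates j) + lalpha j * (ldrift (z0 + j.+1) - (lnn (z0 + j.+1) - lnn (z0 + j))).
Proof.
have -> : lenergy j (lstates j) = lenergy j (lalive (z0 + j.+1) (lstates j)).
  rewrite /lenergy /lalive big_filter [in RHS]big_mkcond; congr (_ * _).
  rewrite big_seq [RHS]big_seq; apply: eq_bigr => m /(allP (linv_lstates j)) /andP[/and3P[_ _ zm] _].
  case: leqP => // mz; have -> : m = (z0 + j)%N by lia.
  by rewrite subrr mulr0.
have -> : lenergy j (lalive (z0 + j.+1) (lstates j)) +
    lalpha j * (ldrift (z0 + j.+1) - (lnn (z0 + j.+1) - lnn (z0 + j))) =
   wprod j * \sum_(m <- lalive (z0 + j.+1) (lstates j)) m%:R^-1 * (lnn m - lnn (z0 + j.+1) + ldrift (z0 + j.+1)).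
  rewrite /lenergy /lalpha /imass -mulrA -mulrDr mulr_suml -big_split /=; congr (_ * _).
  by apply: eq_bigr => m _; ring.
rewrite /lenergy /ladvance /ldrift /=; case: ifP => pz; last first.
  by rewrite mulr1; congr (_ * _); apply: eq_bigr => m _; rewrite addr0.
have p0 : 0 < (z0 + j.+1)%:R :> R by rewrite ltr0n prime_gt0.
rewrite big_cat big_map /= -mulrA -big_split /= mulr_sumr; congr (_ * _).
rewrite big_seq [RHS]big_seq; apply: eq_bigr => m; rewrite mem_filter => /andP[zm _].
rewrite lnnM ?(prime_gt0 pz) ?(leq_trans (prime_gt0 pz) zm) // natrM.
have m0' : 0 < m%:R :> R by rewrite ltr0n (leq_trans (prime_gt0 pz) zm).
move: (lnn m) (lnn _) (m%:R) ((z0 + j.+1)%:R) p0 m0' => a b x y y0 x0.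
by field; neq0_lra.
Qed.

Lemma lenergy_step j : lenergy j.+1 (lstates j.+1) + lenergy j.+1 (lcrossed j) =
  lenergy j (lstates j) + lalpha j * (ldrift (z0 + j.+1) - (lnn (z0 + j.+1) - lnn (z0 + j))).
Proof.
rewrite -lenergy_ladvance /lenergy -mulrDr [in RHS](bigID (fun m => m < Y)%N) /= !big_filter.
by congr (_ * (_ + _)); apply: eq_bigl => m; rewrite ltnNge negbK.
Qed.

(** As [1 / (p + 1) >= 1 / p - 1 / (p (p - 1))], Mertens costs 5 and the convergent sum costs 2. *)
Lemma ldrift_sum_ge k :
  \sum_(0 <= j < k.+1) - (ldrift (z0 + j.+1) - (lnn (z0 + j.+1) - lnn (z0 + j))) <= 7.
Proof.
apply: le_trans (_ : (lnn (z0 + k.+1) - lnn z0) - (mert R (z0 + k.+1) - mert R z0) +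
   (psum (fun p => lnn p / (p%:R * (p%:R - 1))) (z0 + k.+1) -
    psum (fun p => lnn p / (p%:R * (p%:R - 1))) z0) <= _); last first.
  have h1 := psum_ln_sq_le R (z0 + k.+1).
  have h2 : 0 <= psum (fun p => lnn p / (p%:R * (p%:R - 1))) z0.
    apply: psum_ge0 => p pp _; rewrite divr_ge0 ?lnn_ge0 // mulr_ge0 //.
    by rewrite subr_ge0 ler1n prime_gt0.
  have := @mert_diff_ge R z0 (z0 + k.+1); rewrite addn_gt0 z0_gt0 => /(_ isT).
  lra.
have step j : - (ldrift (z0 + j.+1) - (lnn (z0 + j.+1) - lnn (z0 + j))) <=
    lnn (z0 + j.+1) - lnn (z0 + j) - (mert R (z0 + j.+1) - mert R (z0 + j)) +
    (psum (fun p => lnn p / (p%:R * (p%:R - 1))) (z0 + j.+1) -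
     psum (fun p => lnn p / (p%:R * (p%:R - 1))) (z0 + j)).
  rewrite addnS /mert !psumS /ldrift; case: ifP => pz; last lra.
  have l0 := lnn_ge0 R (z0 + j).+1.
  have p1 : 1 < (z0 + j).+1%:R :> R by rewrite ltr1n prime_gt1.
  move: ((z0 + j).+1%:R) (lnn (z0 + j).+1) p1 l0 => x l x1 l0.
  have : 0 <= l / (x + 1) - l / x + l / (x * (x - 1)).
    have -> : l / (x + 1) - l / x + l / (x * (x - 1)) = l * 2 / (x * (x + 1) * (x - 1)).
      by field; neq0_lra.
    by rewrite divr_ge0 ?mulr_ge0 //; lra.
  move: (psum _ _) (psum _ _) (l / _) (l / _) (l / _) => a b c d e; lra.
elim: k => [|k IH].
  by rewrite big_nat1; have := step 0%N; rewrite addn0.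
rewrite big_nat_recr //=; apply: le_trans (lerD IH (step _)) _; lra.
Qed.

(** The drift can consume at most [7 * lalpha 0 <= 7 / m0] of an initial energy of at least
    [8 / m0]. *)
Lemma lenergy_total J : 8 <= lnn m0 - lnn z0 ->
  m0%:R^-1 <= lenergy J (lstates J) + \sum_(0 <= j < J) lenergy j.+1 (lcrossed j).
Proof.
move=> h8; have m0_gt0 : (0 < m0)%N by case/and3P: m0_good.
have mp : 0 < m0%:R^-1 :> R by rewrite invr_gt0 ltr0n.
have E : lenergy J (lstates J) + \sum_(0 <= j < J) lenergy j.+1 (lcrossed j) =
   lenergy 0 (lstates 0) + \sum_(0 <= j < J) lalpha j * (ldrift (z0 + j.+1) - (lnn (z0 + j.+1) - lnn (z0 + j))).
  elim: J => [|J IH]; first by rewrite !big_geq.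
  rewrite !big_nat_recr //=; have := lenergy_step J; rewrite /=; move: IH; lra.
rewrite E; have -> : lenergy 0 (lstates 0) = m0%:R^-1 * (lnn m0 - lnn z0).
  by rewrite /lenergy /= mul1r big_seq1 addn0.
have h : m0%:R^-1 * 8 <= m0%:R^-1 * (lnn m0 - lnn z0) by rewrite ler_wpM2l // ltW.
suff : - \sum_(0 <= j < J) lalpha j * (ldrift (z0 + j.+1) - (lnn (z0 + j.+1) - lnn (z0 + j))) <= m0%:R^-1 * 7.
  move: h; move: (m0%:R^-1 * (_ - _)) => a.
  move: (\sum_(_ <= _ < _) _) (m0%:R^-1) mp => b c c0; lra.
case: J {E} => [|J]; first by rewrite big_geq // oppr0 mulr_ge0 // ltW.
rewrite -sumrN; under eq_bigr do rewrite -mulrN.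
apply: le_trans (_ : lalpha 0 * 7 <= _); last by rewrite ler_wpM2r // lalpha0_le.
apply: (@abel_le R lalpha) => //.
- by move=> k _; exact: lalpha_ge0.
- by move=> k _; exact: lalpha_mono.
- by move=> k _; exact: ldrift_sum_ge.
Qed.

Lemma lcrossed_mass_ge : 8 <= lnn m0 - lnn z0 ->
  m0%:R^-1 <= (\sum_(0 <= j < Y - z0) wprod j.+1 * mass (lcrossed j)) * lnn Y.
Proof.
move=> h8; have zY : (z0 < Y)%N by exact: leq_ltn_trans z0_m0 m0_Y.
apply: le_trans (lenergy_total (Y - z0) h8) _.
(* A state left at time [Y] would satisfy [Y <= m < Y]. *)
have -> : lstates (Y - z0) = [::].
  apply/eqP; rewrite -size_eq0 size_eq0; apply/eqP.
  case E : (lstates (Y - z0)) => [|m s] //; have := linv_lstates (Y - z0); rewrite E /=.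
  by case/andP => /andP[/and3P[_ _]]; rewrite subnKC ?(ltnW zY) // leqNgt => /negbTE ->.
rewrite /lenergy big_nil mulr0 add0r mulr_suml; apply: ler_sum => j _.
rewrite -mulrA ler_wpM2l ?(ltW (wprod_gt0 _)) // /imass mulr_suml.
rewrite big_seq [leRHS]big_seq; apply: ler_sum => M /lcrossedP[pz [m [-> _ h1 mY _]]].
(* With [p] the crossing prime, the potential is [ln (m p) - ln p = ln m]. *)
rewrite ler_wpM2l ?invr_ge0 // lnnM ?(pnat_gt0 h1) ?prime_gt0 // addrK.
by apply: lnn_le; apply: ltnW.
Qed.

End LowerProcess.

(** * Completing prefixes by further primes *)

Lemma sm_nat_le a b n : a <= b -> (sm a).-nat n -> (sm b).-nat n.
Proof. by move=> ab; apply: sub_in_pnat => q _; rewrite !inE => /leq_trans; apply. Qed.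

Lemma sm_decode a m r : (sm a).-nat m -> (sm a)^'.-nat r -> (m * r)`_(sm a) = m.
Proof.
move=> hm hr; rewrite partnM ?(pnat_gt0 hm) ?(pnat_gt0 hr) //.
by rewrite part_pnat_id // part_p'nat ?muln1.
Qed.

Lemma sm'_prime a q : prime q -> a < q -> (sm a)^'.-nat q.
Proof. by move=> qp aq; rewrite pnatE // !inE -ltnNge. Qed.

Lemma sm'_le a b r : a <= b -> (sm b)^'.-nat r -> (sm a)^'.-nat r.
Proof.
move=> ab; apply: sub_in_pnat => q _; rewrite !inE -!ltnNge; exact: leq_ltn_trans.
Qed.

Lemma mem_expand1 q L x : x \in expand q 1 L -> exists2 m, m \in L & x = m \/ x = m * q.
Proof.
case/allpairsP => -[m k] [/= mL kk ->]; exists m => //; move: kk.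
by rewrite !inE => /orP[] /eqP ->; [left; rewrite expn0 muln1|right; rewrite expn1].
Qed.

(** The primes of [r] are adjoined in increasing order and none exceeds [M + 2], so each step
    preserves [good]. *)
Lemma rough1_props M p j r : good M -> (sm p).-nat M -> p + j <= M + 2 ->
  r \in rough_list p j 1 -> [/\ good (M * r), (sm (p + j)).-nat (M * r) & (sm p)^'.-nat r].
Proof.
move=> gM sM; elim: j r => [|j IH] r pj /=.
  by rewrite mem_seq1 => /eqP ->; rewrite muln1 addn0 /pnat.
have IH' s := IH s (leq_trans (leq_add (leqnn p) (leqnSn j)) pj).
case: ifP => pz; last first.
  by move/IH' => [h1 h2 h3]; split=> //; rewrite addnS sm_natS.
case/mem_expand1 => s /IH'[h1 h2 h3] [->|->].
  by split=> //; rewrite addnS sm_natS.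
have lt : p + j < p + j.+1 by rewrite addnS.
rewrite mulnA; split.
- apply: good_mul => //; first exact: sm_nat_ndvd h2 pz lt.
  apply: leq_trans pj _; rewrite leq_add2r leq_pmulr //; exact: pnat_gt0 h3.
- by rewrite pnatM {1}addnS sm_natS //= pnatE // inE.
- by rewrite pnatM h3 sm'_prime // -addn1 leq_add2l.
Qed.

Lemma uniq_rough1 p j : uniq (rough_list p j 1) && all (sm (p + j)).-nat (rough_list p j 1).
Proof.
elim: j => [|j /andP[u /allP IH]] //=; case: ifP => pz; last first.
  by rewrite u /=; apply/allP => r /IH h; rewrite addnS sm_natS.
have lt : p + j < p + j.+1 by rewrite addnS.
apply/andP; split; last first.
  apply/allP => x /mem_expand1[m /IH h [->|->]]; first by rewrite addnS sm_natS.
  by rewrite pnatM {1}addnS sm_natS //= pnatE // inE.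
apply: allpairs_uniq; rewrite ?u ?iota_uniq //.
move=> x y /allpairsP[[m k] [mL _ ->]] /allpairsP[[n l] [nL _ ->]] /= E.
rewrite /= in mL nL.
have h1 := sm'_prime pz lt.
have e a b : (sm (p + j)).-nat a -> (a * (p + j.+1) ^ b)`_(sm (p + j)) = a.
  by move=> ha; rewrite sm_decode // pnatX h1.
have mn : m = n by rewrite -(e m k) ?IH // E e ?IH.
move: E; rewrite mn => /eqP; rewrite eqn_pmul2l ?(pnat_gt0 (IH n nL)) //.
by rewrite eqn_exp2l ?prime_gt1 // => /eqP ->.
Qed.

(* The odd parts of the exponents go to [r], the even parts to [d]. *)
Lemma rough1_decomp n p j : 0 < n -> exists2 r, r \in rough_list p j 1 &
  exists d, n`_(sm (p + j)) = n`_(sm p) * (r * d ^ 2).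
Proof.
move=> n0; elim: j => [|j [r rL [d E]]] /=.
  by exists 1; rewrite ?mem_seq1 //; exists 1; rewrite addn0 !muln1.
rewrite addnS smS // E; case: ifP => pz; last by exists r => //; exists d; rewrite muln1.
set q := (p + j).+1; set k := logn q n.
exists (r * q ^ odd k).
  apply/allpairsP; exists (r, odd k : nat); split=> //.
  by rewrite mem_iota; case: odd.
exists (d * q ^ k./2).
have -> : q ^ k = q ^ odd k * (q ^ k./2) ^ 2.
  by rewrite -expnM -expnD muln2 odd_double_half.
by rewrite expnMn; ring.
Qed.

Definition prime_range a b := [seq q <- index_iota a.+1 b.+1 | prime q].

Lemma mem_prime_range a b q : (q \in prime_range a b) = [&& prime q, a < q & q <= b].
Proof. by rewrite mem_filter mem_index_iota ltnS. Qed.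

Lemma uniq_ext a b S : uniq S -> all (sm a).-nat S ->
  uniq [seq n * q | n <- S, q <- prime_range a b].
Proof.
move=> uS /allP hS; apply: allpairs_uniq => //; first by rewrite filter_uniq // iota_uniq.
move=> x y /allpairsP[[m k] [mL kL ->]] /allpairsP[[n l] [nL lL ->]] /= E.
rewrite /= in mL kL nL lL; move: kL lL; rewrite !mem_prime_range => /and3P[kp ak _] /and3P[lp al _].
have mn : m = n by rewrite -(@sm_decode a m k) ?hS ?sm'_prime // E sm_decode ?hS ?sm'_prime.
move: E; rewrite mn => /eqP; rewrite eqn_pmul2l ?(pnat_gt0 (hS n nL)) // => /eqP ->.
by [].
Qed.

Section LowerCount.
Variable R : realType.
Local Open Scope ring_scope.
Local Notation lnn := (lnnat R).
Local Notation vprod := (vprod R).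
Local Notation mass := (imass R).

Lemma harmonic_ge T : lnn T.+1 <= \sum_(n <- iota 1 T) n%:R^-1.
Proof.
elim: T => [|T IH]; first by rewrite lnn1 big_nil.
rewrite -[X in iota 1 X]addn1 iotaD big_cat /= big_seq1 add1n.
have := lnnS_le R (ltn0Sn T); move: IH; move: (T.+1%:R^-1) => u; lra.
Qed.

(** Every [n <= T] is a [p]-smooth part times [r * d ^ 2] with [r] in [RR], so the harmonic sum up
    to [T] is at most [(vprod p)^-1 * mass RR * 2]. For [T <= p] the truncated [T - p] leaves only
    [r = 1]. *)
Lemma rough1_mass T p : lnn T * vprod p <= 2 * mass [seq r <- rough_list p (T - p) 1 | (r <= T)%N].
Proof.
set RR := [seq r <- _ | _]; have v0 := vprod_gt0 R p.
rewrite -ler_pdivlMr //.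
apply: le_trans (lnn_le R (leqnSn T)) _; apply: le_trans (harmonic_ge T) _.
apply: le_trans (_ : \sum_(n <- [seq (s * x)%N | s <- rough_list 0 p T,
    x <- [seq (r * d ^ 2)%N | r <- RR, d <- iota 1 T]]) n%:R^-1 <= _).
  apply: sum_cover; first exact: iota_uniq; last by move=> t _; rewrite invr_ge0.
  move=> n; rewrite mem_iota add1n ltnS => /andP[n0 nT].
  have [r rL [d E]] := @rough1_decomp n p (T - p) n0.
  rewrite sm_big // in E; last by apply: leq_trans nT _; lia.
  have x0 : (0 < r * d ^ 2)%N by move: n0; rewrite E muln_gt0 => /andP[].
  have [r0 d0] : (0 < r)%N /\ (0 < d)%N.
    by move: x0; rewrite muln_gt0 expn_gt0 orbF => /andP[].
  apply/allpairsP; exists ((n`_(sm p))%N, (r * d ^ 2)%N); split=> //=.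
    have := @rough_listP 0 p T n n0; rewrite add0n sm0; apply=> //.
    by apply: leq_trans nT _; apply: ltnW; apply: ltn_expl.
  have xn : (r * d ^ 2 %| n)%N by rewrite E dvdn_mull.
  apply/allpairsP; exists (r, d); split=> //=.
    rewrite mem_filter rL andbT; apply: leq_trans nT; apply: dvdn_leq => //.
    by apply: dvdn_trans xn; rewrite dvdn_mulr.
  rewrite mem_iota d0 add1n ltnS; apply: leq_trans nT; apply: dvdn_leq => //.
  by apply: dvdn_trans xn; rewrite dvdn_mull // expnS dvdn_mulr.
rewrite big_allpairs_dep /=.
have -> : \sum_(i1 <- rough_list 0 p T) \sum_(i2 <- [seq (r * d ^ 2)%N | r <- RR, d <- iota 1 T]) (i1 * i2)%:R^-1 =
   mass (rough_list 0 p T) * (mass RR * \sum_(d <- iota 1 T) (d ^ 2)%:R^-1).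
  rewrite /imass mulr_suml; apply: eq_bigr => s _.
  rewrite big_allpairs_dep /= mulr_suml mulr_sumr; apply: eq_bigr => r _.
  rewrite mulr_sumr mulr_sumr; apply: eq_bigr => d _.
  by rewrite !natrM !invfM.
have h1 : mass (rough_list 0 p T) <= (vprod p)^-1.
  by have := rough_list_sum R 0 p T; rewrite vprod0 add0n mul1r.
have h2 : \sum_(d <- iota 1 T) (d ^ 2)%:R^-1 <= 2 :> R.
  have h := @sum_inv_sq_le R 1 T isT; rewrite invr1 in h.
  rewrite (bigID (fun d => 1 < d)%N) /=.
  apply: le_trans (lerD h (_ : _ <= 1)) _; last lra.
  rewrite -big_filter; apply: le_trans (_ : \sum_(d <- [:: 1%N]) (d ^ 2)%:R^-1 <= _).
    apply: sum_cover; first by rewrite filter_uniq ?iota_uniq.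
      by move=> d; rewrite mem_filter mem_iota mem_seq1; lia.
    by move=> d _; rewrite invr_ge0.
  by rewrite big_seq1 exp1n invr1.
apply: le_trans (_ : (vprod p)^-1 * (mass RR * 2) <= _); last by rewrite le_eqVlt; apply/orP; left; apply/eqP; ring.
apply: ler_pM => //; first exact: mass_ge0.
  by rewrite mulr_ge0 ?mass_ge0 // sumr_ge0 // => d _; rewrite invr_ge0.
by rewrite ler_wpM2l ?mass_ge0.
Qed.

Lemma sum_prime_range (F : nat -> R) a b : (a <= b)%N ->
  \sum_(q <- prime_range a b) F q = psum F b - psum F a.
Proof.
move=> ab; rewrite big_filter /psum (@big_cat_nat _ _ _ a.+1 0 b.+1) //=.
by rewrite addrC addrK.
Qed.

Lemma sum_inv_prime_range a b : (a <= b)%N -> (0 < b)%N ->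
  lnn b - lnn a - 5 <= lnn b * \sum_(q <- prime_range a b) q%:R^-1.
Proof.
move=> ab b0; apply: le_trans (mert_diff_ge R a b0) _.
rewrite -sum_prime_range // mulr_sumr big_seq [leRHS]big_seq; apply: ler_sum => q.
rewrite mem_prime_range => /and3P[_ _ qb].
by rewrite ler_wpM2r ?invr_ge0 // lnn_le.
Qed.

(** Mertens over [(D / k, D]]: with [ln k >= 6] the error 5 leaves a sum of [ln q / q] of at least
    1, and each term is at most [k * ln D / D]. *)
Lemma prime_range_count k D : (0 < k)%N -> 6 <= lnn k -> (k <= D)%N ->
  D%:R <= k%:R * lnn D * \sum_(q <- prime_range (D %/ k) D) 1.
Proof.
move=> k0 lk kD; have Dk0 : (0 < D %/ k)%N by rewrite divn_gt0.
have D0 : (0 < D)%N by apply: leq_trans kD.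
have h : 1 <= \sum_(q <- prime_range (D %/ k) D) lnn q / q%:R.
  rewrite sum_prime_range ?leq_div // -/(mert R D) -/(mert R _).
  apply: le_trans (mert_diff_ge R _ D0).
  have : lnn (D %/ k * k) <= lnn D by rewrite lnn_le // leq_divM.
  rewrite lnnM //; lra.
have Dp : 0 < D%:R :> R by rewrite ltr0n.
rewrite -[leLHS]mulr1; apply: le_trans (ler_wpM2l (ltW Dp) h) _.
rewrite !mulr_sumr big_seq [leRHS]big_seq; apply: ler_sum => q.
rewrite mem_prime_range => /and3P[qp Dq qD].
have q0 : 0 < q%:R :> R by rewrite ltr0n prime_gt0.
rewrite mulrA ler_pdivrMr // mulr1 mulrAC; apply: ler_pM; rewrite ?lnn_ge0 //.
  rewrite -natrM ler_nat mulnC; apply: ltnW.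
  by apply: leq_trans (ltn_ceil D k0) _; rewrite leq_mul2r Dq orbT.
exact: lnn_le.
Qed.

(* Each [n] in [S] is completed to [n q1 q] with primes [T ^ 10 < q1 <= T ^ 11 < q]. *)
Lemma count_ge_mass k T N (S : seq nat) : (0 < k)%N -> 6 <= lnn k -> (k <= T)%N -> 10 <= lnn T ->
  (T ^ 50 <= N <= T ^ 51)%N -> uniq S ->
  (forall n, n \in S -> [/\ good n, (sm (T ^ 10)).-nat n & (T ^ 16 <= n <= T ^ 27)%N]) ->
  N%:R * mass S <= 44 * k%:R * lnn N * (F_count ustar N)%:R.
Proof.
move=> k0 lk kT lT /andP[N1 N2] uS HS.
have T0 : (0 < T)%N by apply: leq_trans kT.
have TX e : (0 < T ^ e)%N by rewrite expn_gt0 T0.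
have Tle a b : (a <= b)%N -> (T ^ a <= T ^ b)%N by move=> ab; rewrite leq_pexp2l.
have N0 : (0 < N)%N := leq_trans (TX 50) N1.
(* This prime lifts the lower bound [T ^ 16] to [T ^ 26], so that the last prime, at most
   [N / m <= T ^ 25], stays below [m]. *)
pose S2 := [seq (n * q)%N | n <- S, q <- prime_range (T ^ 10) (T ^ 11)].
have uS2 : uniq S2 by apply: uniq_ext => //; apply/allP => n /HS[].
have HS2 m : m \in S2 -> [/\ good m, (sm (T ^ 11)).-nat m & (T ^ 26 <= m <= T ^ 38)%N].
  case/allpairsP => -[n q] [/= /HS[g s /andP[n1 n2]] qr ->].
  move: qr; rewrite mem_prime_range => /and3P[qp q1 q2].
  split.
  - apply: good_mul => //; first exact: sm_nat_ndvd s qp q1.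
    apply: leq_trans q2 (leq_trans _ (leq_addr _ _)).
    by apply: leq_trans n1; apply: Tle.
  - rewrite pnatM (sm_nat_le _ s) ?Tle //= pnatE // inE //.
  - rewrite (_ : 26 = 16 + 10)%N // (_ : 38 = 27 + 11)%N // !expnD !leq_mul //; exact: ltnW.
have massS2 : mass S <= 22 * mass S2.
  have -> : mass S2 = mass S * \sum_(q <- prime_range (T ^ 10) (T ^ 11)) q%:R^-1.
    rewrite /imass big_allpairs_dep /= mulr_suml; apply: eq_bigr => n _.
    by rewrite mulr_sumr; apply: eq_bigr => q _; rewrite natrM invfM.
  have := @sum_inv_prime_range (T ^ 10) (T ^ 11) (Tle 10 11 isT) (TX 11).
  rewrite !lnnX // => h.
  have h22 : 1 <= 22 * \sum_(q <- prime_range (T ^ 10) (T ^ 11)) q%:R^-1 :> R.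
    move: (\sum_(_ <- _) _) h => s h.
    have lT0 : 0 < lnn T by lra.
    rewrite -(ler_pM2l lT0); lra.
  rewrite mulrCA -{1}[mass S]mulr1 ler_wpM2l ?mass_ge0 //.
pose U := [seq (m * q)%N | m <- S2, q <- prime_range (T ^ 11) N].
have uU : uniq U by apply: uniq_ext => //; apply/allP => n /HS2[].
have cnt : \sum_(n <- U | (n <= N)%N) 1 <= (F_count ustar N)%:R :> R.
  rewrite /F_count count_sum -big_filter -[leRHS]big_filter; apply: sum_cover => //.
    by rewrite filter_uniq.
  move=> n; rewrite mem_filter => /andP[nN /allpairsP[[m q] [/= /HS2[g s /andP[m1 m2]] qr E]]].
  move: qr; rewrite mem_prime_range => /and3P[qp q1 q2].
  have : good n.
    rewrite E; apply: good_mul => //; first exact: sm_nat_ndvd s qp q1.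
    apply: leq_trans (leq_addr _ _); apply: (leq_trans _ m1).
    rewrite -(@leq_pmul2l m) ?(pnat_gt0 s) // -E; apply: leq_trans nN (leq_trans N2 _).
    apply: leq_trans (_ : (T ^ 26 * T ^ 26 <= _)%N); first by rewrite -expnD Tle.
    by rewrite leq_mul.
  by case/and3P => n0 pn _; rewrite mem_filter pn mem_iota n0 add1n ltnS.
have main : N%:R * mass S2 <= 2 * k%:R * lnn N * \sum_(n <- U | (n <= N)%N) 1.
  rewrite [in leRHS]big_mkcond big_allpairs_dep /= /imass !mulr_sumr.
  rewrite big_seq [leRHS]big_seq; apply: ler_sum => m /HS2[g s /andP[m1 m2]].
  have m0 : (0 < m)%N := pnat_gt0 s.
  set D := (N %/ m)%N.
  (* [m <= T ^ 38] leaves [D >= T ^ 12], and [k <= T] keeps the interval [(D / k, D]] above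
     [T ^ 11]. *)
  have D1 : (T ^ 12 <= D)%N.
    rewrite leq_divRL //; apply: leq_trans N1.
    by rewrite (_ : 50 = 12 + 38)%N // expnD leq_mul.
  have kD : (T ^ 11 <= D %/ k)%N.
    rewrite leq_divRL //; apply: leq_trans D1.
    by rewrite (_ : 12 = 11 + 1)%N // expnD expn1 leq_mul.
  have D0 : (0 < D)%N := leq_trans (TX 12) D1.
  have kD' : (k <= D)%N.
    by rewrite -[k]mul1n -leq_divRL //; apply: leq_trans (TX 11) kD.
  have e1 : N%:R / m%:R <= 2 * D%:R :> R.
    rewrite ler_pdivrMr ?ltr0n // -!natrM ler_nat.
    apply: ltnW; apply: leq_trans (ltn_ceil N m0) _.
    by rewrite leq_mul2r -/D mul2n -addnn -addn1 leq_add2l D0 orbT.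
  apply: le_trans e1 _; rewrite -!mulrA ler_wpM2l //.
  apply: le_trans (prime_range_count k0 lk kD') _.
  rewrite -mulrA ler_wpM2l //; apply: ler_pM; rewrite ?lnn_ge0 ?lnn_le ?leq_div //.
    by apply: sumr_ge0.
  rewrite -[leRHS]big_mkcond -[leRHS]big_filter; apply: sum_cover => //.
    by rewrite filter_uniq // iota_uniq.
  move=> q; rewrite mem_prime_range mem_filter mem_prime_range => /and3P[qp q1 q2].
  rewrite qp (leq_ltn_trans kD q1) (leq_trans q2 (leq_div _ _)) !andbT.
  by rewrite mulnC -leq_divRL.
have N0' : 0 <= N%:R :> R by [].
apply: le_trans (ler_wpM2l N0' massS2) _.
rewrite mulrCA.
apply: le_trans (ler_wpM2l _ main) _ => //.
have : 2 * k%:R * lnn N * \sum_(n <- U | (n <= N)%N) 1 <= 2 * k%:R * lnn N * (F_count ustar N)%:R.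
  by rewrite ler_wpM2l // !mulr_ge0 ?lnn_ge0.
by move: (\sum_(_ <- _ | _) _) (k%:R) (lnn N) ((F_count _ _)%:R) => a b c d; lra.
Qed.

End LowerCount.

(** * Seeds: crossing prefixes times small factors *)

Section Seeds.
Variables (z0 m0 T : nat).
Let Y := T ^ 10.
Hypotheses (z0_gt0 : 0 < z0) (m0_good : good m0) (m0_sm : (sm z0).-nat m0).
Hypotheses (z0_m0 : z0 <= m0) (m0_Y : m0 < Y) (T_gt1 : 1 < T).

Definition rough_part p := [seq r <- rough_list p (T - p) 1 | r <= T].

Definition seed_triples := [seq (j, x) | j <- iota 0 (Y - z0),
  x <- [seq (M, r) | M <- lcrossed z0 m0 Y j, r <- rough_part (z0 + j.+1)]].

Definition seed_val (t : nat * (nat * nat)) := t.2.1 * t.2.2.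

Lemma seedP j M r : (j, (M, r)) \in seed_triples ->
  [/\ M \in lcrossed z0 m0 Y j, r <= T, good (M * r), (sm (maxn (z0 + j.+1) T)).-nat (M * r)
    & (sm (z0 + j.+1)).-nat M && (sm (z0 + j.+1))^'.-nat r].
Proof.
case/allpairsPdep => j' [x [_ /allpairsP[[M' r'] [/= Mc rr ->]] [-> -> ->]]].
move: rr; rewrite mem_filter => /andP[rT rL].
have [pz [m [eM gM sm_m mY /andP[zm YM]]]] := lcrossedP m0_good m0_sm z0_m0 m0_Y Mc.
have sM : (sm (z0 + j'.+1)).-nat M'.
  by rewrite eM pnatM (sm_nat_le _ sm_m) ?leq_add2l //= pnatE // inE.
have TY : T <= Y by rewrite /Y -{1}[T]expn1 leq_exp2l.
have pM : z0 + j'.+1 + (T - (z0 + j'.+1)) <= M' + 2.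
  rewrite -maxnE geq_max; apply/andP; split; apply: leq_trans (leq_addr _ _).
    by apply: leq_trans zm _; rewrite eM leq_pmulr // prime_gt0.
  exact: leq_trans TY YM.
have [h1 h2 h3] := rough1_props gM sM pM rL.
by split=> //; [rewrite maxnE|rewrite sM h3].
Qed.

(* The crossing time of a product is recovered as the first prefix reaching [Y]. *)
Lemma seed_val_inj : {in seed_triples &, injective seed_val}.
Proof.
have lt_contra j M r j' M' r' : (j, (M, r)) \in seed_triples -> (j', (M', r')) \in seed_triples ->
   M * r = M' * r' -> j < j' -> False.
  move=> /seedP[Mc _ _ _ /andP[sM sr]] /seedP[Mc' _ _ _ /andP[sM' sr']] E jj.
  have [pz [m [_ gM _ _ /andP[_ YM]]]] := lcrossedP m0_good m0_sm z0_m0 m0_Y Mc.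
  have [pz' [m' [eM' _ sm' mY' _]]] := lcrossedP m0_good m0_sm z0_m0 m0_Y Mc'.
  have e : (M * r)`_(sm (z0 + j')) = m'.
    rewrite E eM' -mulnA sm_decode // pnatM sm'_prime ?ltn_add2l //=.
    by apply: sm'_le sr'; rewrite leq_add2l.
  have Mm : M %| m'.
    have <- : M`_(sm (z0 + j')) = M.
      by apply: part_pnat_id; apply: sm_nat_le sM; rewrite leq_add2l.
    by rewrite -e partn_dvd ?dvdn_mulr // muln_gt0 (pnat_gt0 sM) (pnat_gt0 sr).
  have := dvdn_leq (pnat_gt0 sm') Mm.
  by rewrite leqNgt (leq_trans mY' YM).
move=> [j [M r]] [j' [M' r']] t1 t2 E; rewrite /seed_val /= in E.
case: (ltngtP j j') => jj.
- by case: (lt_contra _ _ _ _ _ _ t1 t2 E jj).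
- by case: (lt_contra _ _ _ _ _ _ t2 t1 (esym E) jj).
have [_ _ _ _ /andP[sM sr]] := seedP t1; have [_ _ _ _ /andP[sM' sr']] := seedP t2.
rewrite -jj in sM' sr'.
have MM : M = M' by rewrite -(sm_decode sM sr) E sm_decode.
move: E; rewrite -jj -MM => /eqP; rewrite eqn_pmul2l ?(pnat_gt0 sM) // => /eqP ->.
by [].
Qed.

Lemma uniq_seed_triples : uniq seed_triples.
Proof.
apply: allpairs_uniq_dep; rewrite ?iota_uniq //; last by move=> [j x] [j' x'] _ _ /= [-> ->].
move=> j _; apply: allpairs_uniq; first exact: uniq_lcrossed.
  by rewrite filter_uniq //; case/andP: (uniq_rough1 (z0 + j.+1) (T - (z0 + j.+1))).
by move=> [a b] [c d] _ _ /= [-> ->].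
Qed.

Definition seeds := [seq seed_val t | t <- seed_triples].

Lemma uniq_seeds : uniq seeds.
Proof. rewrite map_inj_in_uniq ?uniq_seed_triples //; exact: seed_val_inj. Qed.

(** A small seed has crossing prime [p] with [p ^ 2 <= M < T ^ 16], which leaves the primes beyond
    [T ^ 8] free to be adjoined. *)
Lemma seedsP n : n \in seeds ->
  [/\ good n, (sm (T ^ 10)).-nat n, T ^ 10 <= n <= T ^ 27 & n < T ^ 16 -> (sm (T ^ 8)).-nat n].
Proof.
case/mapP => -[j [M r]] /seedP[Mc rT gn sn /andP[sM sr]] ->; rewrite /seed_val /=.
have [pz [m [eM gM sm_m mY /andP[zm YM]]]] := lcrossedP m0_good m0_sm z0_m0 m0_Y Mc.
have r0 := pnat_gt0 sr; have TT a b : a <= b -> T ^ a <= T ^ b by move=> ab; rewrite leq_exp2l.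
have Mn : M <= M * r by rewrite leq_pmulr.
have T1 : T <= T ^ 8 by rewrite -{1}[T]expn1 TT.
split=> //.
- apply: sm_nat_le sn; rewrite geq_max (leq_trans zm (ltnW mY)) /=.
  exact: leq_trans T1 (TT 8 10 isT).
- rewrite (leq_trans YM Mn) /=.
  apply: leq_trans (_ : T ^ 10 * T ^ 10 * T ^ 1 <= _); last by rewrite -!expnD TT.
  rewrite expn1 leq_mul // eM leq_mul //; first exact: ltnW.
  by apply: leq_trans zm (ltnW mY).
move=> n16; apply: sm_nat_le sn; rewrite geq_max T1 andbT.
rewrite -(@leq_exp2r _ _ 2) // -expnM; apply: ltnW; apply: leq_ltn_trans n16.
apply: leq_trans Mn; rewrite eM (_ : 2 = 1 + 1) // expnD !expn1 leq_mul2r zm orbT //.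
Qed.

Variable R : realType.
Local Open Scope ring_scope.
Local Notation lnn := (lnnat R).
Local Notation vprod := (vprod R).
Local Notation mass := (imass R).

(** The small factors at [p] have mass at least [ln T * vprod p / 2], which is at least
    [ln T * vprod z0 / 4] times the weight [wprod] of the crossing. The gained [ln T] cancels
    [ln Y = 10 ln T], so the mass is bounded below independently of [T]. *)
Lemma seeds_mass_ge : 8 <= lnn m0 - lnn z0 -> vprod z0 / (40 * m0%:R) <= mass seeds.
Proof.
move=> h8; have lT := lnn_gt0 R T_gt1; have v0 := vprod_gt0 R z0.
have m0p : 0 < m0%:R :> R by rewrite ltr0n; case/and3P: m0_good.
have -> : mass seeds = \sum_(0 <= j < Y - z0) mass (lcrossed z0 m0 Y j) * mass (rough_part (z0 + j.+1)).
  rewrite /imass big_map big_allpairs_dep /= /index_iota subn0; apply: eq_bigr => j _.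
  rewrite big_allpairs_dep /= mulr_suml; apply: eq_bigr => M _.
  by rewrite mulr_sumr; apply: eq_bigr => r _; rewrite /seed_val natrM invfM.
have H := lcrossed_mass_ge z0_gt0 m0_good m0_sm z0_m0 m0_Y h8.
have lY : lnn Y = 10 * lnn T by rewrite /Y lnnX // ltnW.
apply: le_trans (_ : lnn T * vprod z0 / 4 * (\sum_(0 <= j < Y - z0) wprod z0 R j.+1 * mass (lcrossed z0 m0 Y j)) <= _).
  move: H; rewrite lY; move: (\sum_(_ <= _ < _) _) => s h.
  rewrite invfM -[X in X <= _]mulr1.
  have := ler_wpM2l (ltW v0) h; move: (m0%:R^-1) => u; lra.
rewrite mulr_sumr; apply: ler_sum => j _.
have h1 := wprod_le_vprod z0_gt0 R j.+1.
have h2 := rough1_mass R T (z0 + j.+1).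
rewrite -/(rough_part _) in h2.
have c0 := mass_ge0 R (lcrossed z0 m0 Y j).
rewrite mulrA mulrC ler_wpM2l //.
apply: le_trans (_ : lnn T * (2 * vprod (z0 + j.+1)) / 4 <= _); last by move: h2; lra.
have := ler_wpM2l (ltW lT) h1; lra.
Qed.

End Seeds.

(** * Assembly of the two bounds *)

Section Bounds.
Variable R : realType.
Local Open Scope ring_scope.
Local Notation lnn := (lnnat R).
Local Notation vprod := (vprod R).
Local Notation mass := (imass R).

(* Seeds below [T ^ 16] first get an additional prime from [(T ^ 8, T ^ 10]]. *)
Lemma count_ge_seeds z0 m0 k T N : (0 < z0)%N -> good m0 -> (sm z0).-nat m0 -> (z0 <= m0)%N ->
  (m0 < T ^ 10)%N -> 8 <= lnn m0 - lnn z0 -> (0 < k)%N -> 6 <= lnn k -> (k <= T)%N ->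
  10 <= lnn T -> (T ^ 50 <= N <= T ^ 51)%N ->
  N%:R * (vprod z0 / (40 * m0%:R) / 20) <= 44 * k%:R * lnn N * (F_count ustar N)%:R.
Proof.
move=> z0_gt0 gm sm0 zm mY h8 k0 lk kT lT N12.
have T1 : (1 < T)%N by case: T lT {kT mY N12} => [|[|]] //; rewrite ?lnn1 /lnnat ?ln0 //; lra.
have T0 : (0 < T)%N := ltnW T1.
have TX e : (0 < T ^ e)%N by rewrite expn_gt0 T0.
have Tle a b : (a <= b)%N -> (T ^ a <= T ^ b)%N by move=> ab; rewrite leq_exp2l.
set S := seeds z0 m0 T; set c := vprod z0 / _.
have SP := seedsP gm sm0 zm mY T1.
have uS : uniq S := uniq_seeds gm sm0 zm mY T1.
have mS : c <= mass S := seeds_mass_ge z0_gt0 gm sm0 zm mY T1 h8.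
pose Sa := [seq n <- S | (T ^ 16 <= n)%N]; pose Sb := [seq n <- S | ~~ (T ^ 16 <= n)%N].
have mab : mass Sa + mass Sb = mass S by exact: mass_filter.
have a0 := mass_ge0 R Sa; have b0 := mass_ge0 R Sb.
have c0 : 0 < c.
  by rewrite divr_gt0 ?vprod_gt0 // mulr_gt0 // ltr0n; case/and3P: gm.
have NN : 0 <= N%:R :> R by [].
have key L : c / 20 <= mass L ->
   N%:R * mass L <= 44 * k%:R * lnn N * (F_count ustar N)%:R ->
   N%:R * (c / 20) <= 44 * k%:R * lnn N * (F_count ustar N)%:R.
  by move=> h; apply: le_trans; rewrite ler_wpM2l.
(* One of the two parts carries half of [c]; for [Sb] the extra prime costs a factor 10, hence
   [c / 20]. *)
case: (lerP (c / 2) (mass Sa)) => hab.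
  apply: (key Sa); first lra.
  apply: (@count_ge_mass R k T N Sa) => //; first by rewrite filter_uniq.
  move=> n; rewrite mem_filter => /andP[n16 /SP[h1 h2 /andP[_ h3] _]].
  by rewrite n16.
pose Sb' := [seq (n * q)%N | n <- Sb, q <- prime_range (T ^ 8) (T ^ 10)].
have SbP n : n \in Sb -> [/\ good n, (sm (T ^ 8)).-nat n & (T ^ 10 <= n < T ^ 16)%N].
  rewrite mem_filter -ltnNge => /andP[n16 /SP[h1 _ /andP[h2 _] h3]].
  by split=> //; [apply: h3|rewrite h2].
apply: (key Sb').
  have -> : mass Sb' = mass Sb * \sum_(q <- prime_range (T ^ 8) (T ^ 10)) q%:R^-1.
    rewrite /imass big_allpairs_dep /= mulr_suml; apply: eq_bigr => n _.
    by rewrite mulr_sumr; apply: eq_bigr => q _; rewrite natrM invfM.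
  have := @sum_inv_prime_range R (T ^ 8) (T ^ 10) (Tle 8 10 isT) (TX 10).
  rewrite !lnnX // => h.
  have h10 : 1 <= 10 * \sum_(q <- prime_range (T ^ 8) (T ^ 10)) q%:R^-1 :> R.
    move: (\sum_(_ <- _) _) h => s h.
    have lT0 : 0 < lnn T by lra.
    rewrite -(ler_pM2l lT0); lra.
  have := ler_wpM2l b0 h10; move: (\sum_(_ <- _) _) => s; lra.
apply: (@count_ge_mass R k T N Sb') => //.
  apply: uniq_ext; first by rewrite filter_uniq.
  by apply/allP => n /SbP[].
move=> m /allpairsP[[n q] [/= /SbP[g s /andP[n1 n2]] qr ->]].
move: qr; rewrite mem_prime_range => /and3P[qp q1 q2]; split.
- apply: good_mul => //; first exact: sm_nat_ndvd s qp q1.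
  by apply: leq_trans (leq_addr _ _); apply: leq_trans q2 n1.
- by rewrite pnatM (sm_nat_le _ s) ?Tle //= pnatE // inE.
apply/andP; split.
  apply: leq_trans (_ : T ^ 10 * T ^ 8 <= _)%N; first by rewrite -expnD Tle.
  by rewrite leq_mul // ltnW.
apply: leq_trans (_ : T ^ 16 * T ^ 10 <= _)%N; last by rewrite -expnD Tle.
by rewrite leq_mul // ltnW.
Qed.

(** With [ln p >= k / 2] for [2 ^ k <= p], the primes up to 17 contribute exactly 8, and the factor
    19 cancels [ln 19]. *)
Lemma primorial19_ln : 8 <= lnn (primorial 19) - lnn 19.
Proof.
have h k p : (2 ^ k <= p)%N -> k%:R / 2 <= lnn p.
  move=> kp; apply: le_trans (lnn_le R kp); rewrite lnnX //.
  by rewrite ler_wpM2l //; exact: lnn2_ge.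
rewrite !primorialS /= !muln1.
have -> : primorial 0 = 1%N by rewrite /primorial big_mkcond big_nat1.
rewrite mul1n !lnnM //.
have := h 1%N 2%N isT; have := h 1%N 3%N isT; have := h 2%N 5%N isT; have := h 2%N 7%N isT.
have := h 3%N 11%N isT; have := h 3%N 13%N isT; have := h 4%N 17%N isT.
lra.
Qed.

Lemma practical_count_ge : exists2 l : R, 0 < l &
  forall N, (1 < N)%N -> l * N%:R <= (F_count ustar N)%:R * lnn N.
Proof.
have [k [k0 lk]] : exists k, (0 < k)%N /\ 6 <= lnn k.
  exists (2 ^ 12)%N; rewrite expn_gt0 lnnX //; split=> //; have := lnn2_ge R; lra.
have [D lD] : exists D, 10 <= lnn D.
  by exists (2 ^ 20)%N; rewrite lnnX //; have := lnn2_ge R; lra.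
(* [T >= B = 2 ^ 50] will give [N < (T + 1) ^ 50 <= (2 T) ^ 50 <= T ^ 51]. *)
have [B hB] : exists B, forall t, ((2 * t) ^ 50 = B * t ^ 50)%N.
  by exists (2 ^ 50)%N => t; rewrite expnMn.
pose T0 := (k + D + B + primorial 19).+1.
have T0k : (k <= T0)%N by rewrite /T0; lia.
have T0l : 10 <= lnn T0 by apply: le_trans lD _; apply: lnn_le; rewrite /T0; lia.
have T0m : (primorial 19 < T0)%N by rewrite /T0; lia.
have T0B : (B <= T0)%N by rewrite /T0; lia.
clearbody T0.
set c := vprod 19 / (40 * (primorial 19)%:R) / 20.
have c0 : 0 < c.
  by rewrite !divr_gt0 ?vprod_gt0 // mulr_gt0 // ltr0n primorial_gt0.
pose c1 := c / (44 * k%:R); pose c2 := ((2 * (T0 ^ 50)%:R)^-1 : R).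
have kp : 0 < k%:R :> R by rewrite ltr0n.
have c1p : 0 < c1 by rewrite divr_gt0 // mulr_gt0.
have T0p : (0 < T0)%N := leq_trans k0 T0k.
have T0X : 0 < (T0 ^ 50)%:R :> R by rewrite ltr0n expn_gt0 T0p.
have c2p : 0 < c2 by rewrite invr_gt0 mulr_gt0.
exists (Num.min c1 c2); first by rewrite lt_min c1p.
move=> N N1; have [T /andP[TN NT]] := @nat_root_ex 50 N isT.
have N0 : 0 <= N%:R :> R by [].
case: (leqP T0 T) => hT.
  apply: le_trans (_ : c1 * N%:R <= _); first by rewrite ler_wpM2r // ge_min lexx.
  have T1 : (0 < T)%N := leq_trans T0p hT.
  have N2 : (N <= T ^ 51)%N.
    apply: leq_trans (ltnW NT) _.
    apply: leq_trans (_ : (2 * T) ^ 50 <= _)%N; first by rewrite leq_exp2r // mul2n -addnn -addn1 leq_add2l.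
    by rewrite hB (expnS T 50) leq_mul2r (leq_trans T0B hT) orbT.
  have mT : (primorial 19 < T ^ 10)%N.
    by apply: leq_trans T0m (leq_trans hT _); rewrite -{1}[T]expn1 leq_pexp2l.
  have := @count_ge_seeds 19 (primorial 19) k T N isT (good_primorial 19) (sm_nat_primorial 19) _ mT
    primorial19_ln k0 lk (leq_trans T0k hT) (le_trans T0l (lnn_le R hT)).
  rewrite TN N2 => /(_ _ isT) H.
  have {H} := H (dvdn_leq (primorial_gt0 19) (dvdn_primorial (isT : prime 19) (leqnn 19))).
  rewrite -/c /c1 => H.
  rewrite mulrAC ler_pdivrMr ?mulr_gt0 //.
  move: H; move: (k%:R) (lnn N) ((F_count _ _)%:R) (N%:R) => a b d e; lra.
apply: le_trans (_ : c2 * N%:R <= _); first by rewrite ler_wpM2r // ge_min lexx orbT.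
(* For [N < T0 ^ 50] the practical number 1 suffices. *)
have F1 : 1 <= (F_count ustar N)%:R :> R.
  rewrite ler1n /F_count -has_count; apply/hasP; exists 1%N; first by rewrite mem_iota /= add1n ltnS ltnW.
  by case/and3P: good1.
have lN := lnn_ge_half R N1.
apply: le_trans (_ : 1 * 2^-1 <= _); last by apply: ler_pM => //; rewrite invr_ge0.
rewrite mul1r /c2 invfM -mulrA ler_piMr ?invr_ge0 // ler_pdivrMl // mulr1 ler_nat.
apply: leq_trans (ltnW NT) _; by rewrite leq_exp2r.
Qed.

(** For [Y] the integer twelfth root, [ln N <= 12 (ln Y + 1)] is at most [24 ln Y] if [ln Y >= 4],
    and otherwise below 60, where the trivial count [N] suffices. *)
Lemma practical_count_le_ln : exists2 u : R, 0 < u &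
  forall N, (1 < N)%N -> (F_count ustar N)%:R * lnn N <= u * N%:R.
Proof.
have [C C0 hC] := practical_count_le R.
exists (24 * C + 60); first by rewrite addr_gt0 // mulr_gt0.
move=> N N1; have [Y /andP[YN NY]] := @nat_root_ex 12 N isT.
have NN : 0 <= N%:R :> R by [].
have Y0 : (0 < Y)%N.
  by case: Y YN NY => // _; rewrite exp1n ltnS leqn0 => /eqP N0; rewrite N0 in N1.
have lN : lnn N <= 12 * lnn Y.+1.
  by have := lnn_le R (ltnW NY); rewrite lnnX.
have lY1 : lnn Y.+1 <= lnn Y + 1.
  have := lnnS_le R Y0; have : Y%:R^-1 <= 1 :> R by rewrite invf_le1 ?ltr0n // ler1n.
  move: (Y%:R^-1) => t; lra.
have FN : (F_count ustar N)%:R <= N%:R :> R.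
  by rewrite ler_nat /F_count; apply: leq_trans (count_size _ _) _; rewrite size_iota.
have F0 : 0 <= (F_count ustar N)%:R :> R by [].
case: (lerP 4 (lnn Y)) => lY.
  have Y1 : (1 < Y)%N by case: Y lY Y0 {YN NY lN lY1} => [|[|]] //; rewrite lnn1; lra.
  have H := hC N Y Y1 lY YN.
  apply: le_trans (_ : (F_count ustar N)%:R * (24 * lnn Y) <= _).
    by apply: ler_wpM2l => //; lra.
  move: H NN; move: ((F_count _ _)%:R) (lnn Y) (N%:R) => a b d; lra.
apply: le_trans (_ : N%:R * 60 <= _).
  by apply: ler_pM => //; [exact: lnn_ge0|lra].
have : 0 <= C * N%:R by rewrite mulr_ge0 // ltW.
move: (C) (N%:R) => a b; lra.
Qed.

End Bounds.

(* Transfer to the standard reals and to real [X] *)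
From mathcomp Require Import Rstruct Rstruct_topology.
From Stdlib Require Import Reals ZArith Lra.

Lemma practical_count_order :
  exists l u : R, (0 < l)%R /\ (0 < u)%R /\ forall N : nat, leq 2 N ->
    (l * INR N <= INR (F_count ustar N) * ln (INR N))%R /\
    (INR (F_count ustar N) * ln (INR N) <= u * INR N)%R.
Proof.
have [l l0 hl] := practical_count_ge Rdefinitions.R.
have [u u0 hu] := practical_count_le_ln Rdefinitions.R.
exists l, u; split; first exact/RltP; split; first exact/RltP.
move=> N N1; have h1 := hl N N1; have h2 := hu N N1.
rewrite /lnnat in h1 h2.
by split; apply/RleP; rewrite !INRE RlnE.
Qed.

Theorem theorem1p8 :
  exists l u : R, (0 < l)%R /\ (0 < u)%R /\
    forall X : R, (2 <= X)%R ->
      (l * (X / ln X) <= INR (F_count ustar (Z.to_nat (Int_part X))))%R /\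
      (INR (F_count ustar (Z.to_nat (Int_part X))) <= u * (X / ln X))%R.
Proof.
have [l [u [l0 [u0 H]]]] := practical_count_order.
(* The integer part [n] of [X] satisfies [n <= X <= 2 n] and [ln n <= ln X <= 2 ln n], the last
   since [X < n + 1 <= n ^ 2]. *)
exists (l / 2)%R, (2 * u)%R; split; first by Lra.lra.
split; first by Lra.lra.
move=> X X2; have [I1 I2] := base_Int_part X.
have I3 : (2 <= Int_part X)%Z.
  have : (1 < Int_part X)%Z by apply: lt_IZR; Lra.lra.
  by lia.
have EN : INR (Z.to_nat (Int_part X)) = IZR (Int_part X).
  by rewrite INR_IZR_INZ Z2Nat.id //; lia.
have N2 : leq 2 (Z.to_nat (Int_part X)) by apply/ssrnat.leP; lia.
have [] := H _ N2; rewrite EN; move: (pos_INR (F_count ustar (Z.to_nat (Int_part X)))).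
move: (INR (F_count _ _)) => F F0; move/IZR_le: I3.
move: (IZR (Int_part X)) I1 I2 => n I1 I2 n2 H1 H2.
have L0 : (0 < ln n)%R by rewrite -ln_1; apply: ln_increasing; Lra.lra.
have L1 : (ln n <= ln X)%R.
  by case: (Rle_lt_or_eq_dec _ _ I1) => [h|->]; [left; apply: ln_increasing; Lra.lra|right].
have L2 : (ln X <= 2 * ln n)%R.
  have -> : (2 * ln n = ln (n * n))%R by rewrite ln_mult; Lra.lra.
  by left; apply: ln_increasing; Lra.nra.
have LX : (0 < ln X)%R by Lra.lra.
have E : (X / ln X * ln X = X)%R by rewrite /Rdiv Rmult_assoc Rinv_l; Lra.lra.
split; apply: (Rmult_le_reg_r (ln X)) => //; rewrite Rmult_assoc E; Lra.nra.
Qed.
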